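(* There exists a sequence $(v_n)_{n \in \mathbb{N}}$ of non-trivial words $v_n \in \mathbf{F}_2$ such that for every $n \in \mathbb{N}$ the word $v_n$ is a law for all solvable groups of size at most $n$, and $$|v_n| = O\left(\log(n)^{9/2}\right) \quad \text{as } n \to \infty.$$
   Context: $\mathbf{F}_2 = \langle a,b\rangle$ denotes the free group on two generators $a,b$. For $w \in \mathbf{F}_2$, $|w|$ denotes the minimal word length of $w$ when written in terms of $\{a,a^{-1},b,b^{-1}\}$; this is the length of $w$. The word $w$ is non-trivial if it is not the neutral element of $\mathbf{F}_2$. For a group $G$ and $g,h \in G$, $w(g,h) \in G$ denotes the evaluation of $w$ at $a\mapsto g$, $b \mapsto h$. The word $w$ is a law for $G$ if $w(g,h)=1$ for all $g,h \in G$. The notation $|v_n| = O(f(n))$ as $n \to \infty$ means that there are constants $C, n_0$ with $|v_n| \le C f(n)$ for all $n \geq n_0$. *)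

(* Defs.v *)
From HB Require Import structures.
From mathcomp Require Import all_boot all_order all_algebra.
From mathcomp Require Import all_fingroup all_solvable.
From mathcomp Require Import reals exp.

Set Implicit Arguments.
Unset Strict Implicit.
Unset Printing Implicit Defensive.

Local Open Scope group_scope.

(* (false, false) is a, (true, false) is b, and the second component marks
   formal inverses. *)
Definition letter := (bool * bool)%type.

Definition inv_letter (l : letter) : letter := (l.1, ~~ l.2).

Lemma inv_letterK : involutive inv_letter.
Proof. by case=> x y; rewrite /inv_letter /= negbK. Qed.

Definition letter_eval (G : groupType) (g h : G) (l : letter) : G :=
  let x := if l.1 then h else g in if l.2 then x^-1 else x.

Lemma letter_eval_inv (G : groupType) (g h : G) (l : letter) :
  letter_eval g h (inv_letter l) = (letter_eval g h l)^-1.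
Proof. by case: l => x [] /=; rewrite /letter_eval /= ?invgK. Qed.

Definition word_eval (G : groupType) (g h : G) (s : seq letter) : G :=
  \prod_(l <- s) letter_eval g h l.

(* The free group is realised by freely reduced words; the product is
   concatenation followed by free reduction. *)
Definition reduced (s : seq letter) : bool :=
  sorted (fun x y => y != inv_letter x) s.

Record Free2 := MkFree2 { Free2_word :> seq letter; Free2_reduced : reduced Free2_word }.

HB.instance Definition _ := [isSub for Free2_word].
HB.instance Definition _ := [Choice of Free2 by <:].

Definition push (l : letter) (s : seq letter) : seq letter :=
  if s is x :: s' then if x == inv_letter l then s' else l :: s else [:: l].

Lemma push_reduced l s : reduced s -> reduced (push l s).
Proof.
case: s => [|x s] //= rs; case: ifP => [_|/negbT nx] /=; last by rewrite nx.
exact: path_sorted rs.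
Qed.

Lemma foldr_push_reduced s t : reduced t -> reduced (foldr push t s).
Proof. by move=> rt; elim: s => //= l s; apply: push_reduced. Qed.

Lemma pushK l s : reduced s -> push l (push (inv_letter l) s) = s.
Proof.
case: s => [|x s] /=; first by rewrite eqxx.
rewrite inv_letterK; case: eqP => [->|_] /=; last by rewrite eqxx.
by case: s => [|y s] //= /andP[/negPf->].
Qed.

Lemma foldr_push l s t : reduced s -> reduced t ->
  foldr push t (push l s) = push l (foldr push t s).
Proof.
case: s => [|x s] //= rs rt; case: eqP => [->|//].
by rewrite pushK // foldr_push_reduced.
Qed.

Lemma foldr_push_nil s : reduced s -> foldr push [::] s = s.
Proof.
elim: s => //= x s IHs rs; rewrite IHs; last exact: path_sorted rs.
by case: s rs {IHs} => //= y s /andP[/negPf->].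
Qed.

Lemma inv_word_reduced s : reduced s -> reduced (rev (map inv_letter s)).
Proof.
rewrite /reduced rev_sorted sorted_map; apply: sub_sorted => x y /=.
by rewrite inv_letterK; apply: contra => /eqP->.
Qed.

Definition Free2_one : Free2 := @MkFree2 [::] isT.
Definition Free2_mul (u v : Free2) : Free2 :=
  MkFree2 (foldr_push_reduced u (Free2_reduced v)).
Definition Free2_inv (u : Free2) : Free2 := MkFree2 (inv_word_reduced (Free2_reduced u)).

Lemma Free2_mulA : associative Free2_mul.
Proof.
move=> [u ru] [v rv] [w rw]; apply: val_inj => /=.
by elim: u {ru} => //= l u ->; rewrite foldr_push // foldr_push_reduced.
Qed.

Lemma Free2_mul1 : left_id Free2_one Free2_mul.
Proof. by move=> u; apply: val_inj. Qed.

Lemma Free2_mulr1 : right_id Free2_one Free2_mul.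
Proof. by move=> [u ru]; apply: val_inj; apply: foldr_push_nil. Qed.

Lemma Free2_mulV : left_inverse Free2_one Free2_inv Free2_mul.
Proof.
move=> [u ru]; apply: val_inj => /=.
elim: u ru => //= l u IHu rlu; have ru := path_sorted rlu.
rewrite rev_cons -cats1 foldr_cat /= eq_sym inv_letterK eqxx.
exact: IHu.
Qed.

Lemma Free2_mulrV : right_inverse Free2_one Free2_inv Free2_mul.
Proof.
move=> u; have -> : Free2_mul u = Free2_mul (Free2_inv (Free2_inv u)).
  congr Free2_mul; apply: val_inj => /=.
  by rewrite map_rev revK mapK //; apply: inv_letterK.
exact: Free2_mulV.
Qed.

HB.instance Definition _ :=
  isGroup.Build Free2 Free2_mulA Free2_mul1 Free2_mulr1 Free2_mulV Free2_mulrV.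

Definition Free2_a : Free2 := @MkFree2 [:: (false, false)] isT.
Definition Free2_b : Free2 := @MkFree2 [:: (true, false)] isT.

Lemma word_eval_Free2 (w : Free2) : word_eval Free2_a Free2_b w = w.
Proof.
case: w => s rs; apply: val_inj => /=.
elim: s rs => [|l s IHs] rs; rewrite /word_eval ?big_nil // big_cons.
rewrite -/(word_eval Free2_a Free2_b s); have rs' := path_sorted rs.
transitivity (push l (Free2_word (word_eval Free2_a Free2_b s))).
  by case: l {rs} => [[] []].
by rewrite IHs //; case: s rs {IHs rs'} => //= y s /andP[/negPf->].
Qed.

Lemma Free2_spellable (w : Free2) :
  exists n, [exists t : n.-tuple letter, word_eval Free2_a Free2_b t == w].
Proof.
by exists (size w); apply/existsP; exists (in_tuple w); rewrite word_eval_Free2.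
Qed.

Definition Free2_length (w : Free2) : nat := ex_minn (Free2_spellable w).

Definition Free2_eval (G : groupType) (g h : G) (w : Free2) : G := word_eval g h w.

(* Free2_eval g h is the homomorphism determined by a |-> g, b |-> h. *)
Lemma Free2_evalM (G : groupType) (g h : G) :
  {morph Free2_eval g h : u v / u * v >-> u * v}.
Proof.
move=> [u ru] [v rv]; rewrite /Free2_eval /word_eval /=.
elim: u {ru} => [|l u IHu] /=; first by rewrite big_nil mul1g.
rewrite big_cons -mulgA -IHu; case: (foldr _ _ _) => [|x s] /=.
  by rewrite big_cons.
case: eqP => [->|_]; last by rewrite big_cons.
by rewrite big_cons letter_eval_inv mulVKg.
Qed.

Lemma Free2_eval_a (G : groupType) (g h : G) : Free2_eval g h Free2_a = g.
Proof. by rewrite /Free2_eval /word_eval big_cons big_nil mulg1. Qed.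

Lemma Free2_eval_b (G : groupType) (g h : G) : Free2_eval g h Free2_b = h.
Proof. by rewrite /Free2_eval /word_eval big_cons big_nil mulg1. Qed.

Definition is_law (w : Free2) (gT : finGroupType) (G : {group gT}) : Prop :=
  forall g h : gT, g \in G -> h \in G -> Free2_eval g h w = 1.

(* Main.v *)
Require Import Defs.
From mathcomp Require Import all_boot all_order all_algebra.
From mathcomp Require Import all_fingroup all_solvable.
From mathcomp Require Import all_field all_character zify.
From mathcomp Require Import reals exp.

(** The words come from the derived series of the free group: an element of its
    d-th derived subgroup is a law for all groups of derived length at most d,
    and iterating the substitution of [x, y] and [x^-1, y^-1] for x and y
    produces, without any cancellation, such an element of length 4^d
    ([der_words_no_cancellation]).  Since 4^(9/4 log2 log2 n) = (log2 n)^(9/2),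
    it suffices that a solvable group of order at most n has derived length at
    most 9/4 log2 log2 n + O(1) ([solvable_derived_length]).

    To bound derived lengths, ask of each normal section X/Y of a solvable group
    G for which m the subgroup G^`(m) centralises X/Y; for X/Y = G/1 this gives
    the derived length up to one.  By the three subgroup lemma, a subgroup that
    centralises X/Z and Z/Y has a derived subgroup that centralises X/Y
    ([der1_commg_chain]), so the substance is in the chief factors, of order q^k
    say.  There G acts as a linear group of degree k over F_q.  Over an algebraic
    closure the action on a composition factor of degree k' <= k is irreducible.
    Let A be a maximal abelian normal subgroup of its image.  The space is the
    sum of t weight spaces of A, all of the same dimension d, so td = k', and G
    permutes them transitively.  A derived subgroup that fixes all of them
    centralises A.  The centraliser C of A acts on a normal subgroup E of class
    at most 2 with centre A that contains its own centraliser, and E/A embeds in a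
    product of C-sections of order at most d^2: elements of E with different
    commutator pairings on a weight space act on it as linearly independent
    operators ([index_scalar_commutators]).  Once these sections are
    centralised, two more derived steps reach 1 ([der_irr_sub_rker]).  The
    derived subgroups fixing t points are controlled by sections of order at
    most t ([der_sub_index]).

    So a chief factor of order q^k is handled by sections of order at most t and
    d^2 with td <= k, which are much smaller than q^k.  Induction on the order
    shows that 9/4 log2 N - 1 steps suffice for all sections of order N
    ([section_boundT]).  Here the constant 9/4 must be respected exactly, since
    the bounds of nested permutation actions add up.  The estimates are too weak
    only for q = 2 and k <= 5, where GL_k(2) is trivial or the number of prime
    factors of its order bounds the derived length ([der_cent_elementary2]).

    The final bound comes from feeding estimates back into this machine.  A
    section of order at most M^2 consists of two sections of order at most M
    with one chief factor between them, so squaring the order costs two steps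
    more than the worst of its parts ([sections_bounded_square]).  With the
    bound above for chief factors this yields O(log log N) steps for sections of
    order N.  Used for the sections of order d^2, that estimate improves the
    bound for chief factors of degree k to 9/4 log2 k + O(1), and squaring once
    more gives 9/4 log2 log2 N + O(1) for all sections, because 2 < 9/4. *)

Set Implicit Arguments.
Unset Strict Implicit.
Unset Printing Implicit Defensive.
Import Order.TTheory GRing.Theory Num.Theory.

(** * Derived subgroups and the centralisation of normal sections *)

Local Open Scope group_scope.

Section DerivedSeries.
Variable gT : finGroupType.
Implicit Types G H X Y Z : {group gT}.

Lemma derD G m n : G^`(m + n) = G^`(m)^`(n) :> {set gT}.
Proof. by elim: n => [|n IHn]; rewrite ?addn0 ?addnS // !dergSn IHn. Qed.

Lemma der_leq G m n : m <= n -> G^`(n) \subset G^`(m).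
Proof. by move/subnKC <-; rewrite derD der_sub. Qed.

Lemma commg_quotient_sub1 X H Y : X \subset 'N(Y) -> H \subset 'N(Y) ->
  ([~: X, H] \subset Y) = ([~: X / Y, H / Y] == 1).
Proof.
move=> nYX nYH; rewrite -quotientR // -subG1 quotient_sub1 //.
by rewrite comm_subG.
Qed.

(** In the quotient by Y the commutator of X with H twice is trivial, and the three
    subgroup lemma turns this into triviality of the commutator of X with [H, H]. *)
Lemma der1_commg_chain X Z Y H : X \subset 'N(Y) -> Z \subset 'N(Y) -> H \subset 'N(Y) ->
  [~: X, H] \subset Z -> [~: Z, H] \subset Y -> [~: X, H^`(1)] \subset Y.
Proof.
move=> nYX nYZ nYH cXZ cZY.
rewrite commg_quotient_sub1 ?(subset_trans (der_sub 1 H)) // quotient_der //.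
rewrite commg_quotient_sub1 // in cZY.
have XHH: [~: X / Y, H / Y, H / Y] = 1.
  apply/trivgP; rewrite -(eqP cZY) commSg // -quotientR //.
  exact: quotientS.
rewrite commGC; apply/eqP; apply: three_subgroup => //.
by rewrite -[RHS]XHH (commGC (H / Y) (X / Y)).
Qed.

(** The last derived subgroup outside H is normal, and abelian modulo H: it replaces
    a minimal normal subgroup in arguments on the action of G on the cosets of H. *)
Lemma not_sub_der_term G H : solvable G -> ~~ (G \subset H) ->
  exists i, ~~ (G^`(i) \subset H) /\ G^`(i.+1) \subset H.
Proof.
case/derivedP=> n Gn1 nGH.
have ex: exists i, G^`(i) \subset H by exists n; rewrite Gn1 sub1G.
case: (ex_minnP ex) => [[|i]] sGH min; first by rewrite derg0 (negPf nGH) in sGH.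
by exists i; split=> //; apply/negP=> /min; rewrite ltnn.
Qed.

End DerivedSeries.

Local Close Scope group_scope.

(** * Subgroups of small index *)

Local Open Scope group_scope.

(** The integer part of 9/4 log2 N. *)
Definition log94 N := trunc_log 16 (N ^ 9).

Lemma log94_bounds N : 0 < N -> 16 ^ log94 N <= N ^ 9 < 16 ^ (log94 N).+1.
Proof. by move=> N0; apply: trunc_log_bounds; rewrite // expn_gt0 N0. Qed.

Lemma log94_max d N : 16 ^ d <= N ^ 9 -> d <= log94 N.
Proof. by move=> le; apply: trunc_log_max. Qed.

Lemma leq_log94 : {homo log94 : M N / M <= N}.
Proof. by move=> M N le; apply: leq_trunc_log; rewrite leq_exp2r. Qed.

Lemma log94_1 : log94 1 = 0. Proof. by rewrite /log94 exp1n trunc_log1. Qed.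

Lemma log94_gt1 N : 1 < N -> 1 < log94 N.
Proof.
move=> N1; apply: log94_max; apply: (@leq_trans (2 ^ 9)) => //.
by rewrite leq_exp2r.
Qed.

Lemma leq_log94M M N : 0 < M -> 0 < N -> log94 M + log94 N <= log94 (M * N).
Proof.
move=> M0 N0; apply: log94_max; rewrite expnD expnMn.
by apply: leq_mul; [case/andP: (log94_bounds M0) | case/andP: (log94_bounds N0)].
Qed.

(** The predecessor leaves room for one derived step when two sections are put
    together. *)
Definition section_bound N :=
  forall (gT : finGroupType) (G X Y : {group gT}), solvable G ->
  X <| G -> Y <| G -> Y \subset X -> #|X : Y| = N ->
  [~: X, G^`((log94 N).-1)] \subset Y.

(** This is the bound for the transitive action on the cosets of H.  The last derived
    subgroup N not contained in H has orbits of length r > 1, which are the blocks of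
    an imprimitivity system with fewer points.  By induction a derived subgroup fixes
    all blocks.  On a block N acts as a regular abelian group, the section N/Y of
    order r below, and whatever centralises that section acts on the block through
    a regular abelian group as well, so that its derived subgroup fixes the block
    pointwise. *)
Lemma der_sub_index t : (forall r, r <= t -> section_bound r) ->
  forall (gT : finGroupType) (G H : {group gT}), solvable G -> H \subset G ->
  #|G : H| <= t -> G^`(log94 #|G : H|) \subset H.
Proof.
move=> IH gT G H; move: {2}_.+1 (ltnSn #|G : H|) => n.
elim: n H => // n IHn H ltn solG sHG let_.
have [sGH|nsGH] := boolP (G \subset H); first exact: gFsub_trans.
have [i [nsNH sN'H]] := not_sub_der_term solG nsGH.
set N := G^`(i) in nsNH; have nsNG : N <| G := der_normal i G.
have [sNG nNG] := andP nsNG.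
have nNH : H \subset 'N(N) := subset_trans sHG nNG.
pose HN := (H <*> N)%G; have defHN : HN = H * N :> {set gT} := norm_joinEl nNH.
have sHNG : HN \subset G by rewrite join_subG sHG.
have sHHN : H \subset HN := joing_subl H N.
have sNHN : N \subset HN := joing_subr H N.
pose Y := (N :&: H)%G.
have idx : #|HN : H| = #|N : Y|.
  apply/eqP; rewrite -(eqn_pmul2l (cardG_gt0 H)) Lagrange // defHN.
  rewrite -(eqn_pmul2r (cardG_gt0 Y)) -mulnA (mulnC #|N : Y|) Lagrange ?subsetIl //.
  by rewrite mul_cardG setIC.
have r1 : 1 < #|N : Y| by rewrite indexg_gt1 subsetI subxx.
have idxM : #|G : H| = (#|G : HN| * #|N : Y|)%N.
  by rewrite -idx -(Lagrange_index sHNG sHHN).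
have t0 : 0 < #|G : HN| by apply: indexg_gt0.
have ltGHN : #|G : HN| < #|G : H| by rewrite idxM ltn_Pmulr.
have sM : G^`(log94 #|G : HN|) \subset HN.
  by apply: IHn => //; [apply: leq_trans ltGHN _ | apply: leq_trans let_; apply: ltnW].
(* N/Y is a section of HN, the stabiliser of a block. *)
have nsYHN : Y <| HN.
  rewrite /normal (subset_trans (subsetIl _ _) sNHN) /= join_subG.
  apply/andP; split; first by rewrite normsI ?normG.
  rewrite -commg_subr; rewrite subsetI commg_subl.
  rewrite (subset_trans (subsetIl _ _) (normG _)) /=.
  by apply: subset_trans sN'H; rewrite dergSn commgS ?subsetIl.
have nsNHN : N <| HN := normalS sNHN sHNG nsNG.
have solHN : solvable HN := solvableS sHNG solG.
have sec : [~: N, HN^`((log94 #|N : Y|).-1)] \subset Y.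
  apply: (IH #|N : Y|) => //; last exact: subsetIl.
  by apply: leq_trans let_; rewrite idxM leq_pmull.
set Q := HN^`(_) in sec.
have nYHN : HN \subset 'N(Y) := normal_norm nsYHN.
have nYN : N \subset 'N(Y) := subset_trans sNHN nYHN.
have sQHN : Q \subset HN by apply: der_sub.
(* The centraliser of N/Y in HN is a product of N and a point stabiliser T. *)
pose Q2 := (HN :&: 'C(N / Y | 'Q))%G.
have sQQ2 : Q \subset Q2.
  by rewrite subsetI sQHN sub_astabQR ?(subset_trans sQHN) // commGC.
have sNQ2 : N \subset Q2.
  rewrite subsetI sNHN sub_astabQR // -dergSn.
  by rewrite subsetI der_subS.
pose T := (Q2 :&: H)%G.
have defQ2 : Q2 = T * N :> {set gT}.
  by rewrite [RHS](group_modr H sNQ2) -defHN; apply/esym/setIidPl/subsetIl.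
have cNQ2 : [~: Q2, N] \subset Y.
  by rewrite -sub_astabQR ?subsetIr // (subset_trans (subsetIl _ _)).
have nTN : N \subset 'N(T).
  rewrite -commg_subl; apply: subset_trans (_ : Y \subset T).
    by apply: subset_trans cNQ2; rewrite commSg ?subsetIl.
  by rewrite subsetI subsetIr (subset_trans (subsetIl _ _)).
have sQ2T : Q2^`(1) \subset T.
  apply: der1_min; first by rewrite defQ2 mulG_subG normG.
  rewrite defQ2 quotientMidl sub_der1_abelian // subsetI.
  by rewrite (subset_trans (der_sub _ _) sNQ2).
rewrite idxM.
apply: subset_trans (der_leq _ (leq_log94M t0 (ltnW r1))) _.
rewrite derD; apply: subset_trans (dergS _ sM) _.
rewrite -(prednK (ltnW (log94_gt1 r1))) -addn1 derD.
apply: subset_trans (dergS _ sQQ2) _.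
by apply: subset_trans sQ2T _; apply: subsetIr.
Qed.

Local Close Scope group_scope.

(** * Operators with independent scalar commutators *)

Local Open Scope ring_scope.

(** Simultaneous eigenvectors with distinct systems of eigenvalues are independent:
    applying g y minus the eigenvalue at i0 to a relation removes i0 from its
    support. *)
Lemma eigen_family_free (K : fieldType) (V : lmodType K) (I : finType) (Y : Type)
    (P : Y -> Prop) (v : I -> V) (g : Y -> {linear V -> V}) (lam : I -> Y -> K) :
    (forall i, v i != 0) -> (forall i y, P y -> g y (v i) = lam i y *: v i) ->
    (forall i j, (forall y, P y -> lam i y = lam j y) -> i = j) ->
  forall c : I -> K, \sum_i c i *: v i = 0 -> forall i, c i = 0.
Proof.
move=> v0 vg lam_inj c; move: {2}_.+1 (ltnSn #|[pred i | c i != 0]|) => n.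
elim: n c => // n IHn c ltn sum0 i0; apply/eqP/negPn/negP => ci0.
have rec y i : P y -> c i * (lam i y - lam i0 y) = 0.
  move=> Py; move: i; apply: IHn.
    rewrite -ltnS; apply: leq_trans ltn; rewrite ltnS; apply: proper_card; apply/properP; split.
      by apply/subsetP => i; rewrite !inE mulf_eq0 negb_or => /andP[].
    by exists i0; rewrite !inE // subrr mulr0 eqxx.
  transitivity (g y (\sum_i c i *: v i) - lam i0 y *: \sum_i c i *: v i).
    rewrite linear_sum scaler_sumr -sumrB; apply: eq_bigr => i _.
    by rewrite linearZ /= vg // !scalerA -scalerBl mulrBr (mulrC (lam i0 y)).
  by rewrite sum0 linear0 scaler0 subrr.
have c0 i : i != i0 -> c i = 0.
  move=> ne; apply/eqP/negPn/negP => ci; case/eqP: ne; apply: lam_inj => y Py.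
  by apply/eqP; rewrite -subr_eq0; move/eqP: (rec y i Py); rewrite mulf_eq0 (negPf ci).
move: sum0; rewrite (bigD1 i0) //= big1 => [|i /c0->]; last by rewrite scale0r.
by move/eqP; rewrite addr0 scaler_eq0 (negPf ci0) (negPf (v0 _)).
Qed.

Lemma free_family_card (K : fieldType) d (I : finType) (v : I -> 'M[K]_d) :
  (forall c : I -> K, \sum_i c i *: v i = 0 -> forall i, c i = 0) -> (#|I| <= d * d)%N.
Proof.
move=> frv; pose A := \matrix_(i < #|I|) mxvec (v (enum_val i)).
suffices /eqP <-: row_free A by apply: rank_leq_col.
apply: inj_row_free => w wA0; apply/rowP => i; rewrite mxE.
rewrite -[i]enum_valK; apply: (frv (fun x => w 0 (enum_rank x))).
apply: (can_inj mxvecK); rewrite linear0 -wA0 mulmx_sum_row linear_sum /=.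
rewrite (reindex _ (onW_bij _ (@enum_val_bij I))); apply: eq_bigr => j _.
by rewrite linearZ /= rowK enum_valK.
Qed.

(** The operators of a transversal of R in E are simultaneous eigenvectors for
    conjugation by E, because commutators of E are scalars.  The systems of
    eigenvalues separate the cosets of R, so these operators are independent in the
    d^2-dimensional space of all operators. *)
Lemma index_scalar_commutators (K : fieldType) (gT : finGroupType)
    (C E R : {group gT}) d (rC : mx_representation K C d) :
    E \subset C -> R \subset E -> (0 < d)%N ->
    {in E &, forall x y, is_scalar_mx (rC [~ x, y]%g)} ->
    (forall x, x \in E -> {in E, forall y, rC [~ x, y]%g = 1%:M} -> x \in R) ->
  (#|E : R|%g <= d * d)%N.
Proof.
move=> sEC sRE d0 scal radR; pose i0 := Ordinal d0.
have EC x : x \in E -> x \in C := fun h => subsetP sEC x h.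
pose I := {Z : {set gT} | Z \in rcosets R E}.
have -> : #|E : R|%g = #|{: I}| by rewrite card_sig.
have rE (Z : I) : repr (val Z) \in E.
  case: Z => Z /= /rcosetsP[x Ex ->]; case: repr_rcosetP => r Rr.
  by rewrite groupM // (subsetP sRE).
pose lam (Z : I) y := rC [~ repr (val Z), y]%g i0 i0.
have rJ (Z : I) y : y \in E -> rC (repr (val Z) ^ y)%g = lam Z y *: rC (repr (val Z)).
  move=> Ey; have /is_scalar_mxP[a ea] := scal _ _ (rE Z) Ey.
  rewrite conjg_mulR repr_mxM ?EC ?groupR ?rE // /lam ea mxE eqxx mulr1n.
  by rewrite mul_mx_scalar.
apply: (@free_family_card K d I (fun Z => rC (repr (val Z)))).
pose g y : {linear 'M[K]_d -> 'M[K]_d} := mulmxr (rC y) \o mulmx (rC y^-1%g).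
apply: (@eigen_family_free K _ I gT (fun y => y \in E) _ g lam) => [Z|Z y Ey|Z Z' lamE].
- apply/negP => /eqP r0; have := repr_mx_free rC (EC _ (rE Z)).
  by rewrite r0 /row_free mxrank0 => /eqP/esym/eqP; rewrite -leqn0 leqNgt d0.
- rewrite -rJ //= conjgE -mulmxA -!repr_mxM ?groupM ?groupV ?EC ?rE //.
- have : (repr (val Z) * (repr (val Z'))^-1)%g \in R.
    apply: radR => [|y Ey]; first by rewrite groupM ?groupV ?rE.
    set u := (_ * _)%g; have Eu : u \in E by rewrite groupM ?groupV ?rE.
    have Zu : repr (val Z) = (u * repr (val Z'))%g by rewrite mulgKV.
    have Ju : rC (u ^ y)%g = rC u.
      have /row_free_inj: row_free (rC (repr (val Z') ^ y)%g).
        by rewrite repr_mx_free ?EC ?groupJ ?rE.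
      apply; rewrite -repr_mxM ?EC ?groupJ ?rE // -conjMg -Zu rJ // lamE // Zu.
      by rewrite repr_mxM ?EC ?rE // rJ // scalemxAr.
    rewrite /commg repr_mxM ?EC ?groupV ?groupJ // Ju.
    by rewrite -repr_mxM ?EC ?groupV // mulVg repr_mx1.
  rewrite -mem_rcoset; case: Z Z' {rE rJ lamE lam} => Z sZ [Z' sZ'] /= RZ.
  apply: val_inj => /=; move: sZ sZ' RZ.
  case/rcosetsP=> x Ex -> /rcosetsP[x' Ex' ->].
  case: repr_rcosetP => r Rr; case: repr_rcosetP => r' Rr'.
  by rewrite rcosetM rcoset_id // mem_rcoset -mulgA groupMl // -mem_rcoset => /rcoset_eqP.
Qed.

Local Close Scope ring_scope.

(** * Irreducible linear groups *)

Local Open Scope group_scope.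

(** A is a maximal abelian normal subgroup, and E/A is maximal among the abelian normal
    subgroups of G/A inside the centraliser of A.  If the centraliser D of E were not
    contained in A, then the last derived subgroup of D outside A could be added
    to E. *)
Lemma self_centralizing_class2 (gT : finGroupType) (G : {group gT}) : solvable G ->
  exists A E : {group gT}, [/\ A <| G, abelian A, E <| G, [/\ A \subset E, E \subset 'C(A)
    & E^`(1) \subset A] & 'C_G(E) \subset A].
Proof.
move=> solG.
pose gA (A : {set gT}) := (A <| G) && abelian A.
have [A /maxgroupP[/andP[nsAG abA] maxA] _] : {A : {group gT} | maxgroup A gA & 1%G \subset A}.
  by apply: maxgroup_exists; rewrite /gA normal1 abelian1.
pose gE (E : {set gT}) := [&& E <| G, A \subset E, E \subset 'C(A) & [~: E, E] \subset A].
have [E /maxgroupP[/and4P[nsEG sAE cAE E'A] maxE] _] : {E : {group gT} | maxgroup E gE & A \subset E}.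
  apply: maxgroup_exists; rewrite /gE nsAG subxx -/(abelian A) abA.
  by have /derG1P := abA; rewrite derg1 => ->; apply: sub1G.
exists A, E; split => //.
have sZA : 'Z(E) \subset A.
  have := maxA ('Z(E) <*> A)%G; rewrite joing_subr => <- //; first exact: joing_subl.
  rewrite /gA normalY ?gFnormal_trans //= abelianY center_abelian abA /=.
  by rewrite centsC (subset_trans (subsetIr E _)) ?centS.
pose D := 'C_G(E)%G.
have nsDG : D <| G.
  rewrite /normal subsetIl normsI ?normG // norms_cent //.
  exact: normal_norm.
apply/negPn/negP => nsDA.
have solD : solvable D by apply: solvableS solG; apply: normal_sub.
have [i [nsM sM']] := not_sub_der_term solD nsDA.
set M := D^`(i)%G in nsM sM'.
have sMD : M \subset D by apply: der_sub.
have cME : M \subset 'C(E) by rewrite (subset_trans sMD) ?subsetIr.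
have nAG := normal_norm nsAG.
have nsMG : M <| G by apply: gFnormal_trans.
case/negP: nsM; apply: subset_trans sZA; rewrite subsetI cME andbT.
have <- : E <*> M = E; last exact: joing_subr.
apply: maxE (joing_subl _ _); rewrite /gE normalY //=.
rewrite (subset_trans sAE) ?joing_subl //= join_subG cAE.
rewrite (subset_trans cME) ?centS //= -derg1.
have nAE : E \subset 'N(A) := subset_trans (normal_sub nsEG) nAG.
have nAM : M \subset 'N(A) := subset_trans (normal_sub nsMG) nAG.
apply: der1_min; first by rewrite join_subG nAE.
rewrite quotientY // abelianY !sub_der1_abelian //=.
by rewrite quotient_cents // centsC.
Qed.

Local Open Scope ring_scope.
Section Components.
Variables (L : closedFieldType) (gT : finGroupType) (G A : {group gT}) (k : nat).
Variables (rG : mx_representation L G k) (nsAG : A <| G).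
Hypotheses (abA : abelian A) (irrG : mx_irreducible rG).
Let rA := subg_repr rG (normal_sub nsAG).
Variable sH : socleType rA.
Implicit Types W : sH.

(** The simple submodules of A are lines over a closed field, and the isomorphic copies
    that span a component carry the same character. *)
Lemma component_scalar W a : a \in A -> exists c : L, (W *m rG a = c *: (W : 'M_k))%R.
Proof.
move=> Aa; have simW := socle_simple W; set M := socle_base W in simW.
have [modM _ _] := simW.
have rM : \rank M = 1%N.
  exact: (mxsimple_abelian_linear (@group_closure_closed_field L gT A)) abA simW.
have [c cM] : exists c : L, (M *m rG a = c *: M)%R.
  have [u defM] : exists u : 'rV[L]_k, (M :=: u)%MS.
    have rb := eq_row_base M; move: (row_base M) rb; rewrite rM => u rb.
    by exists u; apply: eqmx_sym.
  have /sub_rVP[c uc] : (u *m rG a <= u)%MS.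
    by rewrite -(eqmxMr _ defM) -defM (mxmoduleP modM a Aa).
  exists c; have /submxP[B ->] : (M <= u)%MS by rewrite defM.
  by rewrite -mulmxA uc scalemxAr.
exists c; have [I [V isoV defW]] := component_mx_def simW.
have {defW} -> : W = (\sum_i V i)%MS :> 'M_k := defW.
have scalV i v : (v <= V i)%MS -> (v *m rG a = c *: v)%R.
  have [g injg homg defV] := isoV i => vV.
  have /submxP[B ->] : (v <= M *m g)%MS by rewrite defV.
  rewrite -mulmxA -(hom_mxP homg a Aa) /= cM.
  by rewrite -scalemxAl -scalemxAr.
apply/row_matrixP => i; rewrite row_mul linearZ /=.
have /sub_sumsmxP[u_ ->] : (row i (\sum_i V i)%MS <= \sum_i V i)%MS by apply: row_sub.
rewrite mulmx_suml scaler_sumr; apply: eq_bigr => j _.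
by apply: scalV; apply: submxMl.
Qed.

Lemma component_ext (B1 B2 : 'M[L]_k) : (forall W, W *m B1 = W *m B2)%R -> B1 = B2.
Proof.
move=> eqB; apply/eqP; rewrite -subr_eq0 -(mul1mx (_ - _)%R); apply/eqP/sub_kermxP.
rewrite -(Clifford_Socle1 irrG sH); apply/sumsmx_subP => W _; apply/sub_kermxP.
by rewrite mulmxBr eqB subrr.
Qed.

(** An element preserving each weight space commutes with A, which is scalar on each of
    them. *)
Lemma component_stab_cent (M : {group gT}) : mx_faithful rG -> M \subset G ->
  (forall W, M \subset rstabs rG W) -> M \subset 'C(A).
Proof.
move=> ffG sMG stabM; apply/centsP => x Mx a Aa.
have Gx := subsetP sMG x Mx; have Ga := subsetP (normal_sub nsAG) a Aa.
apply: (mx_faithful_inj ffG); rewrite ?groupM //.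
apply: component_ext => W; have [c cW] := component_scalar W Aa.
rewrite !repr_mxM // !mulmxA cW -scalemxAl.
have /setIdP[_ /submxP[B ->]] := subsetP (stabM W) x Mx.
by rewrite -mulmxA cW -scalemxAr.
Qed.

End Components.
Local Close Scope ring_scope.

(** The bound is a function of d rather than of the order of the section, since only the
    dimension d of a weight space is known. *)
Definition square_sections_bounded (f : nat -> nat) k := forall d, d <= k ->
  forall (gT : finGroupType) (C X Y : {group gT}), solvable C ->
  X <| C -> Y <| C -> Y \subset X -> #|X : Y| <= (d * d)%N -> [~: X, C^`(f d)] \subset Y.

Section Irreducible.
Variables (L : closedFieldType) (f : nat -> nat).

(** Here t is the number of weight spaces of a maximal abelian normal subgroup A, and d
    is their common dimension.  The first term of the sum pays for fixing all weight
    spaces, hence for centralising A; the second for centralising the sections E/R W,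
    whose kernels meet in A; the last two for passing from the centraliser of E/A to
    that of E, which is A, and from there to 1. *)
Lemma der_faithful_irr (gT : finGroupType) (G : {group gT}) k
    (rG : mx_representation L G k) :
    (forall r, r <= k -> section_bound r) -> square_sections_bounded f k ->
    solvable G -> mx_faithful rG -> mx_irreducible rG ->
  exists t d, (t * d)%N = k /\ G^`(log94 t + f d + 2) = 1.
Proof.
move=> secb secsq solG ffG irrG.
have [A [E [nsAG abA nsEG [sAE cAE E'A] cEA]]] := self_centralizing_class2 solG.
have [sAG nAG] := andP nsAG; have [sEG nEG] := andP nsEG.
pose rA := subg_repr rG (normal_sub nsAG).
pose sH : socleType rA := DecSocleType rA.
have [W0 _ _] := imsetP (Clifford_atrans irrG sH).
pose t := #|sH|; pose d := \rank W0.
have t0 : 0 < t by apply/card_gt0P; exists W0.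
have td : (t * d)%N = k by apply: (Clifford_rank_components irrG W0).
have rankW W : \rank (W : sH) = d.
  by apply/eqP; rewrite -(eqn_pmul2l t0) td (Clifford_rank_components irrG W).
have d0 : 0 < d by rewrite lt0n mxrank_eq0; apply: nz_socle.
exists t, d; split=> //.
have tk : t <= k by rewrite -td leq_pmulr.
have dk : d <= k by rewrite -td leq_pmull.
(* The stabiliser of a weight space has index t. *)
have stabW W : G^`(log94 t) \subset rstabs rG (W : sH).
  have eqt : #|G : 'C_G[W | Clifford_action sH]| = t.
    rewrite -card_orbit_in // (atransPin (subxx G) (Clifford_atrans irrG sH)) ?inE //.
    by rewrite cardsT.
  have := der_sub_index secb solG (subsetIl G 'C[W | Clifford_action sH]).
  by rewrite eqt => /(_ tk)/subset_trans; apply; rewrite -Clifford_astab1 subsetIr.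
pose C := 'C_G(A)%G.
have sMC : G^`(log94 t) \subset C.
  rewrite subsetI der_sub.
  exact: (component_stab_cent abA irrG (sH := sH) ffG (der_sub _ _) stabW).
have sEC : E \subset C by rewrite subsetI sEG.
have sCG : C \subset G := subsetIl _ _.
have nEC : C \subset 'N(E) := subset_trans sCG nEG.
have nsEC : E <| C by rewrite /normal sEC.
have solC : solvable C := solvableS sCG solG.
pose Q := C^`(f d)%G.
have sQC : Q \subset C by apply: der_sub.
pose rC := subg_repr rG sCG.
have modW W : mxmodule rC (W : sH).
  rewrite /mxmodule rstabs_subg subsetI subxx /= -Clifford_astab1.
  apply: subset_trans (_ : C \subset 'C([set: sH] | Clifford_action sH)) _.
    exact: subset_trans (joing_subr A C) (Clifford_astab sH).
  by apply: astabS; rewrite sub1set inE.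
pose rW W := submod_repr (modW W); pose Kr W := rker (rW W).
have KrE W : Kr W = C :&: rstab rG (W : sH).
  by rewrite /Kr rker_submod rstab_subg.
(* R W / Kr W is the centre of E / Kr W. *)
pose R W := (E :&: 'C(E / Kr W | 'Q))%G.
have nKr W : C \subset 'N(Kr W) := normal_norm (rker_normal (rW W)).
have nKrE W : E \subset 'N(Kr W) := subset_trans sEC (nKr W).
have memR W x : x \in E -> {in E, forall y, [~ x, y] \in Kr W} -> x \in R W.
  move=> Ex cxE; rewrite inE Ex -sub1set sub_astabQR ?sub1set ?(subsetP (nKrE W)) //; last exact: nKrE.
  rewrite gen_subG; apply/subsetP => _ /imset2P[_ y /set1P-> Ey ->].
  exact: cxE.
have nsRC : forall W : sH, R W <| C.
  move=> W.
  rewrite /normal (subset_trans (subsetIl _ _) sEC) /= normsI //.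
  exact: subset_trans (actsQ (nKr W) nEC) (astab_norm _ _).
have idxR W : #|E : R W| <= (d * d)%N.
  rewrite -(rankW W); apply: (@index_scalar_commutators L gT C E (R W) _ (rW W)) => //.
  - exact: subsetIl.
  - by rewrite rankW.
  - move=> x y Ex Ey /=; have Axy : [~ x, y] \in A by rewrite (subsetP E'A) ?mem_commg.
    have [c cW] := component_scalar abA W Axy; apply/is_scalar_mxP; exists c.
    have valW : (val_submod (1%:M : 'M_(\rank (W : sH))) *m rG [~ x, y] =
                 c *: val_submod (1%:M : 'M_(\rank (W : sH))))%R.
      have /submxP[B ->] := val_submodP (1%:M : 'M_(\rank (W : sH)))%R.
      by rewrite -mulmxA cW -scalemxAr.
    by rewrite /= /submod_mx valW linearZ /= val_submodK scalemx1.
  - move=> x Ex cxE; apply: memR => // y Ey.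
    by rewrite inE (subsetP sEC) ?groupR // mul1mx cxE ?eqxx.
have sQR W : [~: E, Q] \subset R W.
  by apply: secsq (idxR W) => //; apply: subsetIl.
(* An element in all the R W has trivial commutators with E, since the W span. *)
have sRA x : x \in E -> (forall W, x \in R W) -> x \in A.
  move=> Ex RWx; apply: (subsetP cEA); rewrite inE (subsetP sEG) //=.
  apply/centP => y Ey; apply/commgP.
  have Gxy : [~ x, y] \in G by rewrite (subsetP sEG) ?groupR.
  apply/eqP; apply: (mx_faithful_inj ffG) => //; rewrite repr_mx1.
  apply: (component_ext irrG (sH := sH)) => W; rewrite mulmx1.
  have : [~ x, y] \in Kr W.
    have /setIP[_] := RWx W.
    rewrite -sub1set sub_astabQR ?sub1set ?(subsetP (nKrE W)) //; last exact: nKrE.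
    move=> /subsetP; apply.
    by rewrite mem_commg ?set11.
  by rewrite KrE inE => /andP[_]; rewrite inE => /andP[_ /eqP].
have sEQA : [~: E, Q] \subset A.
  apply/subsetP => x EQx; apply: sRA => [|W]; last exact: subsetP EQx.
  by move: x EQx; apply/subsetP; rewrite commg_subl (subset_trans sQC).
have sQ'E : [~: E, Q^`(1)] \subset [1 gT].
  apply: der1_commg_chain sEQA _; rewrite ?norms1 //.
  by rewrite (commG1P _) // centsC (subset_trans sQC) ?subsetIr.
have sQ'A : Q^`(1) \subset A.
  apply: subset_trans cEA; rewrite subsetI (subset_trans (der_sub _ _)) ?(subset_trans sQC) //=.
  by rewrite centsC; apply/commG1P/trivgP.
apply/trivgP; rewrite /= -addnA derD.
apply: subset_trans (dergS _ sMC) _; rewrite derD.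
apply: subset_trans (dergS 1 sQ'A) _.
by rewrite (derG1P _) ?subxx.
Qed.

Lemma der_irr_sub_rker (gT : finGroupType) (G : {group gT}) k
    (rG : mx_representation L G k) :
    (forall r, r <= k -> section_bound r) -> square_sections_bounded f k ->
    solvable G -> mx_irreducible rG ->
  exists t d, (t * d)%N = k /\ G^`(log94 t + f d + 2) \subset rker rG.
Proof.
move=> secb secsq solG irrG.
have irrq : mx_irreducible (kquo_repr rG) by apply/quo_mx_irr.
have [|t [d [td Gq1]]] := der_faithful_irr secb secsq _ (kquo_mx_faithful rG) irrq.
  exact: quotient_sol.
exists t, d; split=> //.
have nKG := rker_norm rG.
by rewrite -quotient_sub1 ?gFsub_trans // quotient_der // Gq1.
Qed.

End Irreducible.

Local Close Scope group_scope.

(** * From chief factors to irreducible representations *)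

Local Open Scope group_scope.

(** All composition factors of a module of degree k have a degree t d <= k. *)
Definition irr_bound (f : nat -> nat) k s :=
  forall t d, 0 < (t * d)%N <= k -> (log94 t + f d + 2 <= s)%N.

Section Unipotent.
Local Open Scope ring_scope.
Variables (L : closedFieldType) (p : nat).
Hypothesis charLp : p \in [pchar L].

Lemma square_zero_expp k (N : 'M[L]_k.+1) : N *m N = 0 -> (1%:M + N) ^+ p = 1%:M.
Proof.
move=> NN0.
have expN m : (1%:M + N) ^+ m = 1%:M + m%:R *: N.
  elim: m => [|m IHm]; first by rewrite scale0r addr0.
  rewrite exprS IHm -mulmxE mulmxDl mul1mx mulmxDr mulmx1 -scalemxAr NN0 scaler0 addr0.
  by rewrite -natr1 scalerDl scale1r addrA.
by rewrite expN (pcharf0 charLp) scale0r addr0.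
Qed.

(** On each composition factor the subgroup G^`(s) acts trivially, so it acts by
    unipotent operators, whose orders are powers of the characteristic. *)
Lemma der_unipotent (f : nat -> nat) s (gT : finGroupType) (G : {group gT}) k
    (rG : mx_representation L G k) :
    (forall r, r <= k -> section_bound r)%N -> square_sections_bounded f k ->
    irr_bound f k s -> solvable G ->
  forall x, x \in (G^`(s))%g -> exists j, rG (x ^+ (p ^ j))%g = 1%:M.
Proof.
have [n ltkn] := ubnP k; elim: n k ltkn rG => // n IHn [|k] ltkn rG secb secsq irrs solG x Gsx.
  by exists 0%N; apply/matrixP => - [].
have nz1 : (1%:M : 'M[L]_k.+1) != 0 by rewrite -mxrank_eq0 mxrank1.
have [M simM _] := dec_mxsimple_exists (mxmodule1 rG) nz1.
have [modM nzM _] := simM.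
have Gx : x \in G by apply: subsetP Gsx; apply: der_sub.
have rM0 : (0 < \rank M)%N by rewrite lt0n mxrank_eq0.
have rMk : (\rank M <= k.+1)%N := rank_leq_row M.
have kM : x \in rker (submod_repr modM).
  have irrM : mx_irreducible (submod_repr modM) by apply/submod_mx_irr.
  have [||t [d [td]]] := @der_irr_sub_rker L f gT G _ (submod_repr modM) _ _ solG irrM.
  - by move=> r /leq_trans/(_ rMk); apply: secb.
  - by move=> d /leq_trans/(_ rMk); apply: secsq.
  move/subsetP; apply; apply: subsetP Gsx; apply: der_leq.
  by apply: irrs; rewrite td rM0.
have rcok : \rank (cokermx M) = (k.+1 - \rank M)%N := mxrank_coker M.
have ltcok : (\rank (cokermx M) < k.+1)%N by rewrite rcok ltn_subrL rM0.
have [j fix_j] : exists j, factmod_repr modM (x ^+ (p ^ j))%g = 1%:M.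
  apply: IHn => //.
  - exact: leq_trans ltcok _.
  - by move=> r /leq_trans/(_ (ltnW ltcok)); apply: secb.
  - by move=> d /leq_trans/(_ (ltnW ltcok)); apply: secsq.
  - move=> t d /andP[td0 tdk]; apply: irrs; rewrite td0 (leq_trans tdk) //.
    exact: ltnW.
set y := (x ^+ (p ^ j))%g in fix_j; have Gy : y \in G by rewrite groupX.
exists j.+1; rewrite expnSr expgM -/y.
have MyM : M *m rG y = M.
  have : y \in rker (submod_repr modM) by apply: groupX.
  by rewrite rker_submod inE => /andP[_ /eqP].
pose N := rG y - 1%:M.
have MN0 : M *m N = 0 by rewrite mulmxBr MyM mulmx1 subrr.
(* N = y - 1 maps the space to M and M to 0, so that N^2 = 0. *)
have NM : (N <= M)%MS.
  rewrite -in_factmod_eq0 linearB /= -[X in in_factmod _ X - _]mul1mx in_factmodJ //.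
  by rewrite -/(factmod_repr modM y) fix_j mulmx1 subrr.
have NN0 : N *m N = 0 by case/submxP: NM => B {1}->; rewrite -mulmxA MN0 mulmx0.
have rX m : rG (y ^+ m)%g = rG y ^+ m.
  by elim: m => [|m IHm]; rewrite ?repr_mx1 // expgS repr_mxM ?groupX // IHm exprS.
rewrite rX -(square_zero_expp NN0) addrC subrK //.
Qed.

End Unipotent.

(** Scalars are extended from F_p to an algebraic closure, where G^`(s) acts by
    unipotent operators.  So its image in the faithful irreducible group G / 'C_G(V)
    is a normal p-subgroup, and such a group is trivial in characteristic p. *)
Lemma der_cent_minnormal (f : nat -> nat) s (gT : finGroupType) (G V : {group gT}) k :
    (forall r, r <= k -> section_bound r) -> square_sections_bounded f k ->
    irr_bound f k s -> solvable G -> minnormal V G -> V \subset G ->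
    logn (pdiv #|V|) #|V| <= k ->
  G^`(s) \subset 'C(V).
Proof.
move=> secb secsq irrs solG minV sVG dimV.
have [nVG ntV abV] := minnormal_solvable minV sVG solG.
have [p p_pr abelV] := is_abelemP abV.
have dimE : 'dim V = logn (pdiv #|V|) #|V|.
  rewrite /abelem_dim' prednK // logn_gt0 mem_primes pdiv_prime ?cardG_gt1 //.
  by rewrite cardG_gt0 pdiv_dvd.
rewrite -dimE in dimV.
pose rV := abelem_repr abelV ntV nVG.
have [L [toL _]] := countable_algebraic_closure 'F_p.
have charL : (p \in [pchar L])%R.
  by apply: (rmorph_pchar toL); apply: pchar_Fp.
pose C := 'C_G(V)%G.
have rkerV : rker rV = C := rker_abelem abelV ntV nVG.
have pelt x : x \in G^`(s) -> exists j, x ^+ (p ^ j)%N \in C.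
  move=> Gsx.
  have [|||j rj] := @der_unipotent L p charL f s gT G _ (map_repr toL rV) _ _ _ solG x Gsx.
  - by move=> r /leq_trans/(_ dimV); apply: secb.
  - by move=> d /leq_trans/(_ dimV); apply: secsq.
  - move=> t d /andP[td0 tdk]; apply: irrs; rewrite td0 (leq_trans tdk) //.
  exists j; rewrite -rkerV -(rker_map toL) inE rj mul1mx eqxx andbT.
  by rewrite groupX // (subsetP (der_sub s G)).
have irrV : mx_irreducible rV by apply/abelem_mx_irrP.
have nKG := rker_norm rV.
have irrq : mx_irreducible (kquo_repr rV) by apply/quo_mx_irr.
have Op1 : 'O_p(G / rker rV) = 1.
  by apply: pcore_faithful_mx_irr_pchar irrq (kquo_mx_faithful rV); apply: pchar_Fp.
have pM : p.-group (G^`(s) / rker rV).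
  apply/pgroupP => q q_pr /(Cauchy q_pr)[xb /morphimP[x Nx Gsx ->] ox].
  have [j Cj] := pelt x Gsx.
  rewrite inE; have : #[coset (rker rV) x] %| (p ^ j)%N.
    by rewrite order_dvdn -morphX //= coset_id // rkerV.
  by rewrite ox Euclid_dvdX // dvdn_prime2 // => /andP[].
have : G^`(s) / rker rV \subset 'O_p(G / rker rV).
  by apply: pcore_max => //; rewrite quotient_normal // der_normal.
rewrite Op1 quotient_sub1 /=; last exact: subset_trans (der_sub s G) nKG.
move=> /subset_trans.
by apply; rewrite rkerV; apply: subsetIr.
Qed.

Local Close Scope group_scope.

(** * Derived length of subgroups of small linear groups over the field with two elements *)

Local Open Scope group_scope.

(** The number of prime factors, counted with multiplicity. *)
Definition Omega n := \sum_(0 <= p < n.+1) logn p n.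

Lemma OmegaE N n : n < N -> Omega n = \sum_(0 <= p < N) logn p n.
Proof.
move=> ltnN; rewrite (@big_cat_nat _ _ _ n.+1 0 N) //=.
rewrite [X in _ = (_ + X)%N]big_nat_cond [X in _ = (_ + X)%N]big1 ?addn0 //.
move=> p /andP[/andP[ltnp _] _].
have [->|n0] := posnP n; first by rewrite logn0.
have [pr|/negPf npr] := boolP (prime p); last by rewrite lognE npr.
by rewrite lognE pr n0; case: ifP => // /(dvdn_leq n0); rewrite leqNgt ltnp.
Qed.

Lemma OmegaM m n : 0 < m -> 0 < n -> Omega (m * n)%N = (Omega m + Omega n)%N.
Proof.
move=> m0 n0; pose N := (m * n).+1.
rewrite (@OmegaE N m) ?ltnS ?leq_pmulr // (@OmegaE N n) ?ltnS ?leq_pmull //.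
by rewrite -big_split /=; apply: eq_bigr => p _; rewrite lognM.
Qed.

Lemma Omega_prime p : prime p -> Omega p = 1%N.
Proof.
move=> pr; rewrite /Omega big_mkord (bigD1 (Ordinal (ltnSn p))) //= logn_prime // eqxx.
rewrite big1 // => i ip; rewrite logn_prime // -(inj_eq val_inj) /= in ip *.
by rewrite (negPf ip).
Qed.

Lemma Omega1 : Omega 1 = 0%N.
Proof. by rewrite /Omega !big_nat_recr //= big_geq. Qed.

Lemma Omega_pdiv n : 1 < n -> Omega n = (Omega (n %/ pdiv n)).+1.
Proof.
move=> n1; have n0 := ltnW n1; have pr := pdiv_prime n1.
rewrite -{1}(divnK (pdiv_dvd n)) mulnC OmegaM ?divn_gt0 ?pdiv_gt0 ?pdiv_leq //.
by rewrite Omega_prime.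
Qed.

Lemma Omega_gt0 n : 1 < n -> 0 < Omega n.
Proof. by move/Omega_pdiv->. Qed.

Lemma Omega_le1_prime n : 1 < n -> Omega n <= 1 -> prime n.
Proof.
move=> n1; have n0 := ltnW n1; have pr := pdiv_prime n1.
rewrite Omega_pdiv // ltnS leqNgt => le0.
have : n %/ pdiv n <= 1 by rewrite leqNgt; apply: contra le0; apply: Omega_gt0.
have d0 : 0 < n %/ pdiv n by rewrite divn_gt0 ?pdiv_gt0 ?pdiv_leq.
by rewrite leq_eqVlt ltnNge d0 orbF => /eqP q1; rewrite -(divnK (pdiv_dvd n)) q1 mul1n.
Qed.

Lemma Omega_dvd m n : 0 < n -> m %| n -> Omega m <= Omega n.
Proof.
move=> n0 /dvdnP[q nE]; move: n0; rewrite nE muln_gt0 => /andP[q0 m0].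
by rewrite OmegaM // leq_addl.
Qed.

Section Der.
Variables (gT : finGroupType).
Implicit Types G H P : {group gT}.

Lemma Omega_Lagrange G H : H \subset G -> Omega #|G| = (Omega #|H| + Omega #|G : H|)%N.
Proof. by move=> sHG; rewrite -(Lagrange sHG) OmegaM. Qed.

(** The automorphism group of a cyclic group is abelian. *)
Lemma der1_cent_cyclic G P : cyclic P -> G \subset 'N(P) -> G^`(1) \subset 'C(P).
Proof.
move=> cycP nPG; rewrite -(ker_conj_aut P).
rewrite -sub_morphim_pre ?(subset_trans (der_sub _ _)) //.
rewrite morphim_der //; apply/trivgP/derG1P.
by apply: abelianS (Aut_cyclic_abelian cycP); apply: Aut_conj_aut.
Qed.

End Der.

(** Modulo G^`(i.+3) the group G^`(i.+2) is cyclic, hence centralised by the derived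
    subgroup of G and central in G^`(i.+1).  A group that is cyclic modulo a central
    subgroup is abelian. *)
Lemma der_succ_cyclic (gT : finGroupType) (G : {group gT}) i :
  cyclic (G^`(i.+1) / G^`(i.+2)) -> cyclic (G^`(i.+2) / G^`(i.+3)) ->
  G^`(i.+2) \subset G^`(i.+3).
Proof.
set N := G^`(i.+3)%G; move=> cyc1 cyc2.
have nsNG : N <| G by apply: der_normal.
have nNG := normal_norm nsNG.
have nNi j : G^`(j) \subset 'N(N) by apply: subset_trans (der_sub _ _) nNG.
have sN2 : N \subset G^`(i.+2) by apply: der_subS.
have cent2 : (G / N)^`(1) \subset 'C(G^`(i.+2) / N).
  apply: der1_cent_cyclic => //.
  by rewrite quotient_norms // der_norm.
change (G^`(i.+1)^`(1) \subset N); apply: der1_min (nNi i.+1) _.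
apply: (@cyclic_factor_abelian _ (G^`(i.+2) / N)).
  rewrite subsetI quotientS ?der_subS //= centsC.
  apply: subset_trans cent2; rewrite -quotient_der // quotientS //.
  by apply: der_leq; lia.
have nsN1 : N <| G^`(i.+1) by rewrite /normal nNi andbT; apply: der_leq; lia.
by rewrite (isog_cyclic (third_isog sN2 nsN1 (der_normalS _ _))).
Qed.

(** Each step of the derived series contributes at least one prime factor to the order,
    and two consecutive steps after the first contribute at least three, because they
    cannot both be cyclic. *)
Lemma Omega_der (gT : finGroupType) (G : {group gT}) : solvable G ->
  forall d, G^`(d) != 1 -> 0 < d -> ((3 * d).+1 <= 2 * Omega #|G|)%N.
Proof.
move=> solG.
have proper_der i : G^`(i) != 1 -> 1 < #|G^`(i) : G^`(i.+1)|.
  move=> ntGi; rewrite indexg_gt1.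
  have /properP[_ [x Gx nGx]] := sol_der1_proper solG (der_sub i G) ntGi.
  by apply/subsetPn; exists x.
have nt_leq i j : i <= j -> G^`(j) != 1 -> G^`(i) != 1.
  by move=> leij; apply: contraNneq => Gi1; rewrite -subG1 -Gi1 der_leq.
have step i : G^`(i.+2) != 1 -> 3 <= Omega #|G^`(i.+1) : G^`(i.+3)|.
  move=> nt2; have nt1 := nt_leq _ _ (leqnSn _) nt2.
  have i1 := proper_der _ nt1; have i2 := proper_der _ nt2.
  have -> : Omega #|G^`(i.+1) : G^`(i.+3)| =
            (Omega #|G^`(i.+1) : G^`(i.+2)| + Omega #|G^`(i.+2) : G^`(i.+3)|)%N.
    by rewrite -(Lagrange_index (der_subS i.+1 G) (der_subS i.+2 G)) OmegaM ?indexg_gt0 // addnC.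
  rewrite ltnNge; apply/negP => le2.
  have o1 := Omega_gt0 i1; have o2 := Omega_gt0 i2.
  have pr1 : prime #|G^`(i.+1) : G^`(i.+2)| by apply: Omega_le1_prime => //; lia.
  have pr2 : prime #|G^`(i.+2) : G^`(i.+3)| by apply: Omega_le1_prime => //; lia.
  move: i2; rewrite indexg_gt1 der_succ_cyclic // prime_cyclic //.
    by rewrite card_quotient // normal_norm // der_normalS.
  by rewrite card_quotient // normal_norm // der_normalS.
(* The induction on j advances by two derived steps. *)
have sub_der2 i : Omega #|G^`(i.+1)| = (Omega #|G^`(i.+3)| + Omega #|G^`(i.+1) : G^`(i.+3)|)%N.
  by apply: Omega_Lagrange; apply: der_leq; lia.
have low j : forall i, G^`((i.+1 + j)%N) != 1 -> (3 * j + 2 <= 2 * Omega #|G^`(i.+1)|)%N.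
  have [n] := ubnP j; elim: n j => // n IHn [|[|j]] ltj i.
  - rewrite addn0 => nt; have : 0 < Omega #|G^`(i.+1)| by rewrite Omega_gt0 // cardG_gt1.
    lia.
  - rewrite addn1 => nt; have := step i nt.
    have := sub_der2 i; lia.
  - move=> nt; have := IHn j (ltnW ltj) i.+2; have -> : (i.+3 + j = i.+1 + j.+2)%N by lia.
    move=> /(_ nt).
    have : G^`(i.+2) != 1 by apply: nt_leq nt; lia.
    move=> /step.
    have := sub_der2 i; lia.
case=> // d nt _; have := low d 0 nt.
have nt0 : G^`(0) != 1 by apply: nt_leq nt.
have := Omega_gt0 (proper_der 0 nt0).
have : Omega #|G| = (Omega #|G^`(1)| + Omega #|G^`(0) : G^`(1)|)%N.
  by apply: Omega_Lagrange; apply: der_sub.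
lia.
Qed.

Lemma Omega_GL2 k : 1 < k <= 5 -> Omega #|'GL_k['F_2]| = nth 0 [:: 0; 0; 2; 5; 10; 15] k.
Proof.
have O2 j : Omega (2 ^ j)%N = j.
  by elim: j => [|j IHj]; rewrite ?Omega1 // expnS OmegaM ?expn_gt0 // IHj Omega_prime.
move=> lek; have k0 : 0 < k by lia.
have o1 : Omega (2 ^ 1 - 1) = 0%N := Omega1.
have o2 : Omega (2 ^ 2 - 1) = 1%N := @Omega_prime 3 isT.
have o3 : Omega (2 ^ 3 - 1) = 1%N := @Omega_prime 7 isT.
have o4 : Omega (2 ^ 4 - 1) = 2%N.
  by rewrite (_ : 2 ^ 4 - 1 = 3 * 5)%N // OmegaM // !Omega_prime.
have o5 : Omega (2 ^ 5 - 1) = 1%N := @Omega_prime 31 isT.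
rewrite card_GL // card_Fp // big_add1 big_mkord.
case: k lek k0 => [|[|[|[|[|[|k]]]]]] // _ _;
  rewrite !big_ord_recr big_ord0 /= mul1n !OmegaM ?muln_gt0 // ?O2 ?o1 ?o2 ?o3 ?o4 ?o5 ?(@Omega_prime 2 isT) //.
Qed.

(** For k >= 2 the k-th entry is the bound 9/4 k - 1 of [section_bound] for sections of order 2^k,
    rounded down. *)
Definition gl2_steps := [:: 0; 0; 3; 5; 8; 10].

(** Otherwise [Omega_der] would give GL_k(2) at least 5, 8, 13 and 16 prime factors for
    k = 2, 3, 4 and 5. *)
Lemma der_order_GL2 (gT : finGroupType) (G : {group gT}) k : solvable G -> 1 < k <= 5 ->
  #|G| %| #|'GL_k['F_2]| -> G^`(nth 0 gl2_steps k) = 1.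
Proof.
move=> solG lek dvG; apply/eqP/negPn/negP => nt.
have := Omega_dvd (cardG_gt0 _) dvG; rewrite Omega_GL2 //.
have := Omega_der solG nt.
by case: k lek {nt dvG} => [|[|[|[|[|[|k]]]]]] //= _; lia.
Qed.

Lemma der_cent_elementary2 (gT : finGroupType) (G V : {group gT}) k : solvable G ->
  G \subset 'N(V) -> 2.-abelem V -> #|V| = (2 ^ k)%N -> 1 < k <= 5 ->
  G^`(nth 0 gl2_steps k) \subset 'C(V).
Proof.
move=> solG nVG abelV cardV lek.
have ntV : V :!=: 1 by rewrite -cardG_gt1 cardV -{1}(expn0 2) ltn_exp2l //; lia.
have dimE : 'dim V = k by rewrite (dim_abelemE abelV ntV) cardV pfactorK.
pose rV := abelem_repr abelV ntV nVG.
have rkerV : rker rV = 'C_G(V) := rker_abelem abelV ntV nVG.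
have nKG := rker_norm rV.
rewrite -dimE in lek *; set m := nth _ _ _.
suffices : G^`(m) \subset rker rV.
  by rewrite rkerV => /subset_trans; apply; apply: subsetIr.
rewrite -quotient_sub1 ?(subset_trans (der_sub _ _)) // quotient_der //.
rewrite (der_order_GL2 _ lek) ?quotient_sol //.
rewrite /= -(ker_reprGLm rV) (card_isog (first_isog (reprGL_morphism rV))).
exact: cardSg (subsetT _).
Qed.

Local Close Scope group_scope.

(** * Arithmetic of the section bound *)

Lemma log94_exp2 k : log94 (2 ^ k) = (9 * k) %/ 4.
Proof.
apply/eqP; rewrite eqn_leq; apply/andP; split.
  have /andP[le _] := @log94_bounds (2 ^ k) ltac:(by rewrite expn_gt0).
  move: le; rewrite -expnM (_ : 16 = 2 ^ 4) // -expnM leq_exp2l // leq_divRL // mulnC.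
  by rewrite (mulnC k).
apply: log94_max; rewrite (_ : 16 = 2 ^ 4) // -!expnM leq_exp2l //.
by rewrite mulnC (mulnC k) leq_trunc_div.
Qed.

Lemma log94_3 : 3 <= log94 3. Proof. exact: log94_max. Qed.

Lemma log94_lt N c : 0 < N -> N ^ 9 < 16 ^ c -> log94 N < c.
Proof.
move=> N0 ltN; have /andP[le _] := log94_bounds N0.
by rewrite -(ltn_exp2l _ _ (isT : 1 < 16)) (leq_ltn_trans le).
Qed.

(** For sections of order 2^6 the real inequality between the bounds fails with d = 6 and
    t = 1, and only the rounding of 9/4 log2 36 = 11.6... rescues the induction. *)
Lemma log94_36 : log94 (6 * 6) < 12.
Proof.
apply: log94_lt; first by [].
(* 36^9 = 4^9 9^9 < 4^9 4^15 = 16^12, because 9^3 < 4^5. *)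
have cube x y : 0 < x -> y ^ 3 < x ^ 5 -> (x * y) ^ 9 < (x * x) ^ 12.
  move=> x0 ltyx; rewrite (mulnn x) -(expnM x 2 12) (expnD x 9 15) expnMn.
  by rewrite ltn_pmul2l ?expn_gt0 ?x0 // (expnM y 3 3) (expnM x 5 3) ltn_exp2r.
exact: (@cube 4 9).
Qed.

Lemma leq_3k_exp q k : 2 < q -> 3 * k <= q ^ k.
Proof.
move=> q3; apply: (@leq_trans (3 ^ k)); last first.
  by case: k => // k; rewrite leq_exp2r.
by elim: k => // -[|k] // IHk; rewrite expnS; lia.
Qed.

Lemma leq_2kk_exp q k : 2 < q -> 1 < k -> 2 * (k * k) <= q ^ k.
Proof.
move=> q3 k1; apply: (@leq_trans (3 ^ k)); last by rewrite leq_exp2r //; lia.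
elim: k k1 => // -[|[|[|k]]] // IHk _; rewrite expnS.
by have := IHk isT; move: (3 ^ _) => e; nia.
Qed.

Lemma leq_3k_exp2 k : 3 < k -> 3 * k <= 2 ^ k.
Proof.
elim: k => // k IHk; rewrite ltnS leq_eqVlt => /predU1P[<- //|k3].
by have := IHk k3; rewrite expnS; move: (2 ^ _) => e; lia.
Qed.

Lemma leq_2kk_exp2 k : 6 < k -> 2 * (k * k) <= 2 ^ k.
Proof.
elim: k => // k IHk; rewrite ltnS leq_eqVlt => /predU1P[<- //|k7].
by have := IHk k7; rewrite expnS; move: (2 ^ _) => e; nia.
Qed.

(** The bound of [section_bound] for sections of order at most d^2. *)
Definition section_length d := (log94 (d * d)).-1.

(** For d = 1 the claim follows from 3 t <= q^k, and for d > 1 from 2 t d^2 <= q^k.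
    With td <= k these hold when 3 k <= q^k and 2 k^2 <= q^k, respectively; the second
    one fails for q = 2 and k = 6. *)
Lemma irr_bound_section_length q k : 0 < k -> (2 < q) || (q == 2) && (5 < k) ->
  irr_bound section_length k (log94 (q ^ k)).-1.
Proof.
move=> k0 qk t d /andP[td0 tdk]; rewrite /section_length.
have [t0 d0] : 0 < t /\ 0 < d by apply/andP; rewrite -muln_gt0.
suffices : log94 t + (log94 (d * d)).-1 + 3 <= log94 (q ^ k) by lia.
have [d1|d1] := leqP d 1.
  have -> : d = 1 by lia.
  rewrite log94_1 /= addn0; apply: (@leq_trans (log94 t + log94 3)).
    by rewrite leq_add2l log94_3.
  apply: leq_trans (leq_log94M _ _) _ => //; apply: leq_log94.
  have tk : t * 3 <= 3 * k by nia.
  apply: leq_trans tk _; case/orP: qk => [q3|/andP[/eqP-> k5]].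
    exact: leq_3k_exp.
  by apply: leq_3k_exp2; lia.
have dd1 : 1 < d * d by nia.
have b2 := log94_gt1 dd1.
have [/andP[/andP[/eqP q2 /eqP k6] d6]|nq] := boolP ((q == 2) && (k == 6) && (5 < d)).
  have [-> ->] : t = 1 /\ d = 6 by nia.
  have := log94_36; rewrite q2 k6 log94_exp2 log94_1; move: (log94 (6 * 6)) => b.
  by have -> : 9 * 6 %/ 4 = 13 by []; lia.
suffices le : 2 * (t * (d * d)) <= q ^ k.
  have := leq_log94 le; have := @leq_log94M 2 (t * (d * d)) isT; rewrite !muln_gt0 t0 d0.
  move=> /(_ isT); have := @leq_log94M t (d * d) t0; rewrite muln_gt0 d0 => /(_ isT).
  have := log94_gt1 (isT : 1 < 2); lia.
have kk : t * (d * d) <= k * k by rewrite mulnA; apply: leq_mul => //; nia.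
case/orP: qk => [q3|/andP[/eqP q2 k5]].
  apply: leq_trans (leq_2kk_exp q3 _); last by nia.
  by rewrite leq_mul2l.
have [k6|k6] := ltnP 6 k.
  by rewrite q2; apply: leq_trans (leq_2kk_exp2 k6); rewrite leq_mul2l.
have {k5 k6} k6 : k = 6 by lia.
move: nq; rewrite q2 k6 !eqxx /= -leqNgt => d5.
rewrite (_ : 2 ^ 6 = 64) //.
have : t * d <= 6 by rewrite -k6.
have : t <= 3 by nia.
case: t t0 {td0 tdk kk} => [|[|[|[|t]]]] // _ _; nia.
Qed.

(** * The bound for sections of a given order *)

Local Open Scope group_scope.

Definition chief_section (gT : finGroupType) (G X Y : {group gT}) :=
  X != Y /\ forall Z : {group gT}, Z <| G -> Y \subset Z -> Z \subset X -> Z = Y \/ Z = X.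

Section Chief.
Variables (gT : finGroupType) (G X Y : {group gT}).
Hypotheses (nsXG : X <| G) (nsYG : Y <| G) (sYX : Y \subset X).

Lemma chief_minnormal : chief_section G X Y -> minnormal (X / Y) (G / Y).
Proof.
case=> neXY chiefXY; have nYG := normal_norm nsYG.
apply/mingroupP; split.
  rewrite quotient_norms ?normal_norm // andbT.
  apply: contra neXY => /eqP XY1; rewrite -val_eqE /= eqEsubset sYX andbT.
  rewrite -quotient_sub1 ?XY1 // (subset_trans _ nYG) ?normal_sub //.
move=> H /andP[ntH nHG] sHXY.
have nsH : H <| G / Y by rewrite /normal nHG (subset_trans sHXY) // quotientS ?normal_sub.
have [Z defH sYZ nsZG] := inv_quotientN nsYG nsH.
have sZX : Z \subset X.
  rewrite -(quotientSGK _ sYX) -?defH //.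
  exact: subset_trans (normal_sub nsZG) nYG.
case: (chiefXY Z nsZG sYZ sZX) => ZE; last by rewrite defH ZE.
by case/negP: ntH; rewrite defH ZE trivg_quotient.
Qed.

Lemma commg_quotient_cent m : (G / Y)^`(m) \subset 'C(X / Y) -> [~: X, G^`(m)] \subset Y.
Proof.
have nYG := normal_norm nsYG => cXG.
rewrite commg_quotient_sub1 ?(subset_trans _ nYG) ?normal_sub ?der_normal //.
by apply/eqP/commG1P; rewrite centsC quotient_der.
Qed.

(** This is [der_cent_minnormal] in the quotient by Y. *)
Lemma chief_section_bound (f : nat -> nat) s q k :
    (forall r, r <= k -> section_bound r) -> square_sections_bounded f k ->
    irr_bound f k s -> solvable G -> chief_section G X Y ->
    prime q -> #|X : Y| = (q ^ k)%N -> 0 < k ->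
  [~: X, G^`(s)] \subset Y.
Proof.
move=> secb secsq irrs solG chiefXY q_pr cardXY k0; apply: commg_quotient_cent.
have cV : #|X / Y| = (q ^ k)%N.
  by rewrite card_quotient // (subset_trans _ (normal_norm nsYG)) ?normal_sub.
apply: (der_cent_minnormal secb secsq irrs).
- exact: quotient_sol.
- exact: chief_minnormal.
- by rewrite quotientS ?normal_sub.
- by rewrite cV; case: (k) k0 => // k' _; rewrite pdiv_pfactor // pfactorK.
Qed.

Lemma chief_section_card : solvable G -> chief_section G X Y ->
  exists q k, [/\ prime q, q.-abelem (X / Y), 0 < k & #|X : Y| = (q ^ k)%N].
Proof.
move=> solG chiefXY; have minV := chief_minnormal chiefXY.
have [_ ntV /is_abelemP[q q_pr abelV]] :=
  minnormal_solvable minV (quotientS _ (normal_sub nsXG)) (quotient_sol Y solG).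
have [_ _ [k cV]] := pgroup_pdiv (abelem_pgroup abelV) ntV.
exists q, k.+1; split=> //; rewrite -cV card_quotient //.
by rewrite (subset_trans _ (normal_norm nsYG)) ?normal_sub.
Qed.

Lemma not_chief_section : X != Y ->
  chief_section G X Y \/ exists Z : {group gT},
    [/\ Z <| G, Y \subset Z, Z \subset X, Z != Y & Z != X].
Proof.
move=> neXY.
have [/existsP[Z /and5P[]]|] := boolP [exists Z : {group gT},
   [&& Z <| G, Y \subset Z, Z \subset X, Z != Y & Z != X]].
  by right; exists Z.
rewrite negb_exists => /forallP noZ; left; split=> // Z nsZ sYZ sZX.
have := noZ Z; rewrite nsZ sYZ sZX /= negb_and !negbK.
by case/orP => /eqP; [left | right].
Qed.

End Chief.

Lemma der1_section_chain (gT : finGroupType) (G X Z Y : {group gT}) m n :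
    X <| G -> Z <| G -> Y <| G ->
    [~: X, G^`(m)] \subset Z -> [~: Z, G^`(n)] \subset Y ->
  [~: X, G^`((maxn m n).+1)] \subset Y.
Proof.
move=> nsX nsZ nsY cXZ cZY.
have nYG := normal_norm nsY.
have sub H : H <| G -> H \subset 'N(Y) by move=> nsH; apply: subset_trans (normal_sub nsH) nYG.
rewrite -addn1 derD; apply: der1_commg_chain (sub _ nsX) (sub _ nsZ) (sub _ (der_normal _ _)) _ _.
  by apply: subset_trans cXZ; rewrite commgS // der_leq // leq_maxl.
by apply: subset_trans cZY; rewrite commgS // der_leq // leq_maxr.
Qed.

Lemma commg_der_leq (gT : finGroupType) (G X Y : {group gT}) m n : m <= n ->
  [~: X, G^`(m)] \subset Y -> [~: X, G^`(n)] \subset Y.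
Proof. by move=> lemn; apply: subset_trans; rewrite commgS ?der_leq. Qed.

(** A section that is not a chief factor splits in two, and the spare step of
    [section_bound] pays for the chain.  A chief factor of order q^k needs sections of
    order at most k or k^2, which are smaller than q^k whenever [der_cent_elementary2]
    does not apply. *)
Theorem section_boundT N : section_bound N.
Proof.
elim/ltn_ind: N => N IHN gT G X Y solG nsX nsY sYX cardXY.
have nYG := normal_norm nsY; have sXG := normal_sub nsX.
have [->|neXY] := eqVneq X Y.
  by rewrite commg_subl (subset_trans (der_sub _ _)).
have [chiefXY|[Z [nsZ sYZ sZX neZY neZX]]] := not_chief_section G neXY; last first.
  have idx : N = (#|X : Z| * #|Z : Y|)%N by rewrite -cardXY Lagrange_index.
  have i1 : 1 < #|X : Z|.
    by rewrite indexg_gt1; apply: contra neZX => sXZ; rewrite -val_eqE eqEsubset sZX.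
  have i2 : 1 < #|Z : Y|.
    by rewrite indexg_gt1; apply: contra neZY => sXZ; rewrite -val_eqE eqEsubset sYZ andbT.
  have lt1 : #|X : Z| < N by rewrite idx ltn_Pmulr // ltnW.
  have lt2 : #|Z : Y| < N by rewrite idx ltn_Pmull // ltnW.
  have := der1_section_chain nsX nsZ nsY (IHN _ lt1 _ _ _ _ solG nsX nsZ sZX erefl)
                                       (IHN _ lt2 _ _ _ _ solG nsZ nsY sYZ erefl).
  apply: commg_der_leq.
  have := leq_log94M (ltnW i1) (ltnW i2); rewrite -idx.
  have := log94_gt1 i1; have := log94_gt1 i2; lia.
have [q [k [q_pr abelV k0 cXY]]] := chief_section_card nsX nsY sYX solG chiefXY.
have q1 := prime_gt1 q_pr.
have cV : #|X / Y| = (q ^ k)%N by rewrite card_quotient // (subset_trans sXG).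
have NE : N = (q ^ k)%N by rewrite -cardXY.
have [small|large] := boolP ((q == 2) && (k <= 5)).
  have [/eqP q2 k5] := andP small; apply: commg_quotient_cent => //.
  have [k1|k1] := leqP k 1.
    have k1E : k = 1%N by apply/eqP; rewrite eqn_leq k1.
    rewrite NE k1E q2 (@log94_exp2 1) /=; apply: der1_cent_cyclic.
      by apply: prime_cyclic; rewrite cV k1E q2.
    by rewrite quotient_norms ?normal_norm.
  rewrite NE q2 log94_exp2; subst q.
  apply: subset_trans (der_cent_elementary2 (quotient_sol Y solG) _ abelV cV _); last first.
  - by rewrite k1.
  - by rewrite quotient_norms ?normal_norm.
  apply: der_leq; clear -k1 k5.
  by case: k k1 k5 => [|[|[|[|[|[|k]]]]]].
have qk : (2 < q) || (q == 2) && (5 < k).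
  have [q2|q3] : q = 2 \/ 2 < q by lia.
    by move: large; rewrite q2 eqxx /= -ltnNge => ->.
  by rewrite q3.
have kkN : (k * k)%N < N.
  rewrite NE; case/orP: qk => [q3|/andP[/eqP-> k5]].
    have [->|k2] : k = 1%N \/ 1 < k by lia.
      by rewrite expn1; lia.
    have := leq_2kk_exp q3 k2; nia.
  have [->//|k6] : k = 6 \/ 6 < k by lia.
  have := leq_2kk_exp2 k6; nia.
have kN : k < N by nia.
rewrite NE; apply: (@chief_section_bound _ _ _ _ nsX nsY sYX section_length _ q k) => //.
- by move=> r rk; apply: IHN; apply: leq_ltn_trans kN.
- move=> d dk gT' C X' Y' solC nsX' nsY' sYX' led.
  have ltN : #|X' : Y'| < N by apply: leq_ltn_trans led _; apply: leq_ltn_trans kkN; apply: leq_mul.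
  apply: commg_der_leq (IHN _ ltN _ _ _ _ solC nsX' nsY' sYX' erefl).
  by rewrite /section_length; have := leq_log94 led; lia.
- exact: irr_bound_section_length.
Qed.

Local Close Scope group_scope.

(** * Doubly logarithmic bounds *)

Local Open Scope group_scope.

Definition sections_bounded M D := forall (gT : finGroupType) (G X Y : {group gT}),
  solvable G -> X <| G -> Y <| G -> Y \subset X -> #|X : Y| <= M -> [~: X, G^`(D)] \subset Y.

Definition chief_sections_bounded M s := forall (gT : finGroupType) (G X Y : {group gT}),
  solvable G -> X <| G -> Y <| G -> Y \subset X -> #|X : Y| <= M ->
  chief_section G X Y -> [~: X, G^`(s)] \subset Y.

(** Let Z be maximal with Z/Y of order at most M, and W/Z a chief factor.  Then W/Y has
    order greater than M, so X/W has order less than M, and X/Y is a chain of three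
    sections. *)
Lemma sections_bounded_square M D s : 0 < M -> sections_bounded M D ->
  chief_sections_bounded (M * M)%N s -> sections_bounded (M * M)%N (maxn D s).+2.
Proof.
move=> M0 secD chiefs gT G X Y solG nsX nsY sYX leXY.
pose gP (Z : {set gT}) := [&& Z <| G, Y \subset Z, Z \subset X & #|Z : Y| <= M].
have [Z /maxgroupP[/and4P[nsZ sYZ sZX leZ] maxZ] _] : {Z : {group gT} | maxgroup Z gP & Y \subset Z}.
  by apply: maxgroup_exists; rewrite /gP nsY subxx sYX indexgg.
have [ZX|neZX] := eqVneq Z X.
  rewrite -ZX; apply: commg_der_leq (secD _ _ _ _ solG nsZ nsY sYZ leZ); lia.
pose gQ (W : {set gT}) := [&& W <| G, Z \subset W, W \subset X & W != Z].
have [W /mingroupP[/and4P[nsW sZW sWX neWZ] minW] _] : {W : {group gT} | mingroup W gQ & W \subset X}.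
  by apply: mingroup_exists; rewrite /gQ nsX sZX subxx -val_eqE eq_sym /= in neZX *.
have chiefWZ : chief_section G W Z.
  split=> // H nsH sZH sHW; have [->|neHZ] := eqVneq H Z; first by left.
  right; apply/val_inj/minW => //; apply/and4P; split=> //.
  exact: subset_trans sWX.
(* Otherwise W would contradict the maximality of Z. *)
have leW : M < #|W : Y|.
  rewrite ltnNge; apply/negP => leW; case/eqP: neWZ; apply: maxZ => //.
  by rewrite /gP nsW sWX leW (subset_trans sYZ).
have sYW := subset_trans sYZ sZW.
have XWY : (#|X : W| * #|W : Y|)%N = #|X : Y| := Lagrange_index sWX sYW.
have WZY : (#|W : Z| * #|Z : Y|)%N = #|W : Y| := Lagrange_index sZW sYZ.
have i1 : 0 < #|Z : Y| := indexg_gt0 _ _.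
have i2 : 0 < #|X : W| := indexg_gt0 _ _.
have cXW : [~: X, G^`(D)] \subset W.
  apply: secD => //; rewrite -(leq_pmul2r M0); apply: leq_trans leXY.
  by rewrite -XWY leq_mul2l ltnW ?orbT.
have cWZ : [~: W, G^`(s)] \subset Z.
  apply: chiefs => //; apply: leq_trans leXY; rewrite -XWY -WZY.
  by rewrite (leq_trans (leq_pmulr _ i1)) // leq_pmull.
have cZY : [~: Z, G^`(D)] \subset Y by apply: secD.
have cXZ := der1_section_chain nsX nsW nsZ cXW cWZ.
apply: commg_der_leq (der1_section_chain nsX nsZ nsY cXZ cZY).
by clear; lia.
Qed.

Lemma sections_bounded_double (D s : nat -> nat) :
    (forall j, chief_sections_bounded (2 ^ (2 ^ j))%N (s j)) ->
    0 < D 0 -> (forall j, (maxn (D j) (s j.+1) + 2 <= D j.+1)%N) ->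
  forall j, sections_bounded (2 ^ (2 ^ j))%N (D j).
Proof.
move=> chiefs D0 DS; elim=> [|j IHj] gT G X Y solG nsX nsY sYX leXY.
  apply: commg_der_leq (@section_boundT _ _ G X Y solG nsX nsY sYX erefl).
  by have := leq_log94 leXY; rewrite (@log94_exp2 1) /=; lia.
have sq : (2 ^ 2 ^ j.+1 = 2 ^ 2 ^ j * 2 ^ 2 ^ j)%N by rewrite expnS mul2n -addnn expnD.
rewrite sq in leXY.
have chief_sq : chief_sections_bounded (2 ^ 2 ^ j * 2 ^ 2 ^ j)%N (s j.+1) by rewrite -sq.
have := @sections_bounded_square _ _ _ _ IHj chief_sq gT G X Y solG nsX nsY sYX leXY.
rewrite expn_gt0 => /(_ isT); apply: commg_der_leq; have := DS j; lia.
Qed.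

(** A chief factor of order q^k <= 2^(2^j) has degree k <= 2^j. *)
Lemma chief_sections_bounded_irr (f : nat -> nat) j s :
    square_sections_bounded f (2 ^ j)%N -> irr_bound f (2 ^ j)%N s ->
  chief_sections_bounded (2 ^ (2 ^ j))%N s.
Proof.
move=> secsq irrs gT G X Y solG nsX nsY sYX leXY chiefXY.
have [q [k [q_pr _ k0 cXY]]] := chief_section_card nsX nsY sYX solG chiefXY.
have kj : k <= 2 ^ j.
  rewrite -(leq_exp2l _ _ (isT : 1 < 2)) (leq_trans _ leXY) // cXY.
  by rewrite leq_exp2r // prime_gt1.
apply: (@chief_section_bound _ _ _ _ nsX nsY sYX f s q k) => //.
- by move=> r _; apply: section_boundT.
- by move=> d /leq_trans/(_ kj); apply: secsq.
- by move=> t d /andP[td0 tdk]; apply: irrs; rewrite td0 (leq_trans tdk).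
Qed.

(** A first doubly logarithmic bound: since t d^2 <= 4^j, a chief factor takes at most
    9/2 j + 2 steps. *)
Lemma sections_bounded_crude j : sections_bounded (2 ^ (2 ^ j))%N (5 * j + 4)%N.
Proof.
apply: (@sections_bounded_double (fun j => 5 * j + 4)%N
  (fun j => 5 * j + 2)%N) => // [|i]; last by lia.
move=> {}j; apply: (@chief_sections_bounded_irr section_length) => [d _ gT C X Y solC nsX nsY sYX led|].
  apply: commg_der_leq (@section_boundT _ _ C X Y solC nsX nsY sYX erefl).
  by rewrite /section_length; have := leq_log94 led; lia.
move=> t d /andP[td0 tdk]; rewrite /section_length.
have [t0 d0] : 0 < t /\ 0 < d by apply/andP; rewrite -muln_gt0.
have le : (t * (d * d) <= 2 ^ (2 * j))%N.
  by rewrite mul2n -addnn expnD mulnA leq_mul // (leq_trans _ tdk) // leq_pmull.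
have := leq_log94 le; rewrite log94_exp2.
by have := @leq_log94M t (d * d)%N t0; rewrite muln_gt0 d0 => /(_ isT); lia.
Qed.

(** The bound of [sections_bounded_crude] for the least tower 2^(2^m) above d^2. *)
Definition loglog_length d := (5 * up_log 2 (up_log 2 (d * d)) + 4)%N.

(** The line 16 m - 48 is the secant of 2^m through m = 4 and m = 5. *)
Lemma exp2_secant m : (16 * m <= 2 ^ m + 48)%N.
Proof.
have [m4|] := leqP m 4; first by case: m m4 => [|[|[|[|[|m]]]]].
elim: m => // m IHm; rewrite ltnS leq_eqVlt => /predU1P[<- //|m4].
by have := IHm m4; rewrite expnS; move: (2 ^ m)%N => e; lia.
Qed.

(** With 2^i <= d the number t is at most 2^(j - i), so the first summand saves 9/4 i,
    which dominates the second one, logarithmic in i. *)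
Lemma irr_bound_loglog_length j : irr_bound loglog_length (2 ^ j)%N (9 * j %/ 4 + 40)%N.
Proof.
move=> t d /andP[td0 tdj]; rewrite /loglog_length.
have [t0 d0] : 0 < t /\ 0 < d by apply/andP; rewrite -muln_gt0.
pose i := trunc_log 2 d.
have /andP[led ltd] : 2 ^ i <= d < 2 ^ i.+1 by apply: trunc_log_bounds.
have tij : (t * 2 ^ i <= 2 ^ j)%N by apply: leq_trans tdj; rewrite leq_mul2l led orbT.
have ij : i <= j.
  by rewrite -(leq_exp2l _ _ (isT : 1 < 2)) (leq_trans _ tij) // leq_pmull.
have tji : t <= 2 ^ (j - i).
  by rewrite -(@leq_pmul2r (2 ^ i)) ?expn_gt0 // -expnD subnK.
have := leq_log94 tji; rewrite log94_exp2 => bt.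
set u := up_log 2 (d * d); set m := up_log 2 u.
have ui : (u <= 2 * i + 2)%N.
  apply: up_log_min => //; rewrite (_ : (2 * i + 2 = i.+1 + i.+1)%N); last by lia.
  by rewrite expnD leq_mul // ltnW.
have mi : 2 ^ m <= (4 * i + 4)%N.
  have [u1|u1] := leqP u 1.
    by rewrite /m; case: (u) u1 => [|[|]] // _; rewrite ?up_log0 ?up_log1 //; lia.
  have := up_log_bounds (isT : 1 < 2) u1; rewrite -/m => /andP[lt _].
  have m0 : 0 < m by rewrite /m up_log_gt0.
  by rewrite -(prednK m0) expnS; move: lt; move: (2 ^ _)%N => e; lia.
have := exp2_secant m; move: mi; move: (2 ^ m)%N => e; lia.
Qed.

Lemma sections_bounded_loglog j : sections_bounded (2 ^ (2 ^ j))%N (9 * j %/ 4 + 42)%N.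
Proof.
apply: (@sections_bounded_double (fun j => 9 * j %/ 4 + 42)%N
  (fun j => 9 * j %/ 4 + 40)%N) => // [|i]; last by lia.
move=> {}j; apply: (@chief_sections_bounded_irr loglog_length); last exact: irr_bound_loglog_length.
move=> d _ gT C X Y solC nsX nsY sYX led.
apply: sections_bounded_crude => //; apply: leq_trans led _.
apply: leq_trans (up_logP _ (isT : 1 < 2)) _.
by rewrite leq_exp2l // up_logP.
Qed.

(** Centralising the section G/1 means being central, hence abelian. *)
Theorem solvable_derived_length (gT : finGroupType) (G : {group gT}) j :
  solvable G -> #|G| <= 2 ^ (2 ^ j) -> G^`((9 * j %/ 4 + 43)%N) = 1.
Proof.
move=> solG leG; apply/trivgP; rewrite /= addnS dergSn.
have := @sections_bounded_loglog j gT G G 1%G solG (normal_refl G) (normal1 G) (sub1G G).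
rewrite indexg1 => /(_ leG); apply: subset_trans.
by rewrite commSg // der_sub.
Qed.

Local Close Scope group_scope.

(** * Short words in the derived series of the free group *)

Section Words.
Local Open Scope group_scope.

Definition inv_word (s : seq letter) := rev (map inv_letter s).

(** The two words are the commutators [x, y] and [x^-1, y^-1] in the convention
    x^-1 y^-1 x y. *)
Fixpoint der_words d : seq letter * seq letter :=
  if d is d'.+1 then
    let: (x, y) := der_words d' in
    (inv_word x ++ inv_word y ++ x ++ y, x ++ y ++ inv_word x ++ inv_word y)
  else ([:: (false, false)], [:: (true, false)]).

Lemma size_inv_word s : size (inv_word s) = size s.
Proof. by rewrite size_rev size_map. Qed.

Lemma size_der_words d :
  size (der_words d).1 = (4 ^ d)%N /\ size (der_words d).2 = (4 ^ d)%N.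
Proof.
elim: d => //= d; case: (der_words d) => x y /= [sx sy].
by rewrite !size_cat !size_inv_word sx sy expnS; split; lia.
Qed.

Lemma word_eval_cat (G : groupType) (g h : G) s t :
  word_eval g h (s ++ t) = word_eval g h s * word_eval g h t.
Proof. by rewrite /word_eval big_cat. Qed.

Lemma word_eval_inv (G : groupType) (g h : G) s :
  word_eval g h (inv_word s) = (word_eval g h s)^-1.
Proof.
elim: s => [|l s IHs]; first by rewrite /word_eval /inv_word /= !big_nil invg1.
rewrite /inv_word /= rev_cons -cats1 word_eval_cat -/(inv_word s) IHs.
rewrite [X in _ * X]/word_eval [X in _ = X^-1]/word_eval !big_cons big_nil mulg1.
by rewrite letter_eval_inv invgM.
Qed.

Lemma der_words_eval (gT : finGroupType) (G : {group gT}) (g h : gT) d :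
    g \in G -> h \in G ->
  word_eval g h (der_words d).1 \in G^`(d) /\ word_eval g h (der_words d).2 \in G^`(d).
Proof.
move=> Gg Gh; elim: d => [|d] /=.
  by rewrite /word_eval !big_cons !big_nil /letter_eval /= !mulg1.
case: (der_words d) => x y /= [Gx Gy].
rewrite !word_eval_cat !word_eval_inv; set u := word_eval g h x in Gx *.
set w := word_eval g h y in Gy *; rewrite dergSn; split.
  by rewrite (_ : _ * _ = [~ u, w]) ?mem_commg // /commg /conjg !mulgA.
rewrite (_ : _ * _ = [~ u^-1, w^-1]) ?mem_commg ?groupV //.
by rewrite /commg /conjg !invgK !mulgA.
Qed.

Lemma reduced_cat l0 s t : s != [::] -> t != [::] ->
  reduced (s ++ t) = [&& reduced s, reduced t & head l0 t != inv_letter (last l0 s)].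
Proof.
case: s => // a s _; case: t => // b t _.
by rewrite /reduced /= cat_path /= andbC -andbA andbCA andbA andbC.
Qed.

Lemma head_inv_word l0 s : s != [::] -> head l0 (inv_word s) = inv_letter (last l0 s).
Proof. by case/lastP: s => // s x _; rewrite /inv_word map_rcons rev_rcons last_rcons. Qed.

Lemma last_inv_word l0 s : s != [::] -> last l0 (inv_word s) = inv_letter (head l0 s).
Proof. by case: s => // x s _; rewrite /inv_word /= rev_cons last_rcons. Qed.

Lemma inv_word_nil s : (inv_word s == [::]) = (s == [::]).
Proof. by rewrite -!size_eq0 size_inv_word. Qed.

Lemma head_cat (T : eqType) (l0 : T) s t : s != [::] -> head l0 (s ++ t) = head l0 s.
Proof. by case: s. Qed.

Lemma last_cat_neq_nil (T : eqType) (l0 : T) s t : t != [::] -> last l0 (s ++ t) = last l0 t.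
Proof. by case: t => // a t _; rewrite last_cat. Qed.

Lemma cat_neq_nil (T : eqType) (s t : seq T) : t != [::] -> s ++ t != [::].
Proof. by case: s. Qed.

(** The six inequalities between first and last letters prevent cancellation in both
    words of the next step, and they are inherited by these. *)
Definition no_cancellation l0 (x y : seq letter) :=
  let fx := head l0 x in let lx := last l0 x in
  let fy := head l0 y in let ly := last l0 y in
  [&& reduced x, reduced y, x != [::] & y != [::]] &&
  [&& fx != fy, lx != ly, fy != inv_letter lx, fx != inv_letter ly,
      fx != inv_letter lx & fy != inv_letter ly].

Lemma der_words_no_cancellation l0 d :
  no_cancellation l0 (der_words d).1 (der_words d).2.
Proof.
elim: d => //= d; case: (der_words d) => x y /=.
case/andP=> /and4P[rx ry x0 y0] /and5P[n1 n2 n3 n4 /andP[n5 n6]].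
have inj := inv_inj inv_letterK.
have [ix0 iy0] : inv_word x != [::] /\ inv_word y != [::] by rewrite !inv_word_nil.
have rix : reduced (inv_word x) := inv_word_reduced rx.
have riy : reduced (inv_word y) := inv_word_reduced ry.
have nz := (x0, y0, ix0, iy0, cat_neq_nil).
rewrite /no_cancellation !(reduced_cat l0) ?nz // !(head_cat, last_cat_neq_nil) ?nz //.
rewrite !(head_inv_word, last_inv_word) ?nz // !inv_letterK rx ry rix riy /=.
have n6' : last l0 y != inv_letter (head l0 y).
  by rewrite -(inj_eq inj) inv_letterK eq_sym.
by rewrite !(inj_eq inj) !(eq_sym (inv_letter _)) n1 n2 n3 n4 n5 n6'.
Qed.

Lemma der_words_reduced d : reduced (der_words d).1.
Proof. by case/andP: (der_words_no_cancellation (false, false) d) => /and4P[]. Qed.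

Definition der_word d : Free2 := MkFree2 (der_words_reduced d).

Lemma der_word_neq1 d : der_word d <> 1.
Proof.
move/(congr1 (fun w : Free2 => size w)) => /= s0.
by have [] := size_der_words d; rewrite s0 => /esym/eqP; rewrite expn_eq0.
Qed.

Lemma Free2_length_leq (w : Free2) : Free2_length w <= size w.
Proof.
rewrite /Free2_length; case: ex_minnP => n _; apply.
by apply/existsP; exists (in_tuple w); rewrite word_eval_Free2.
Qed.

Lemma Free2_length_der_word d : Free2_length (der_word d) <= 4 ^ d.
Proof. by apply: leq_trans (Free2_length_leq _) _; have [->] := size_der_words d. Qed.

Lemma der_word_law (gT : finGroupType) (G : {group gT}) d :
  G^`(d) = 1 -> is_law (der_word d) G.
Proof.
move=> Gd1 g h Gg Gh; have [] := der_words_eval d Gg Gh.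
by rewrite Gd1 => /set1P.
Qed.

End Words.

Local Open Scope ring_scope.

Definition law_exponent n := (9 * up_log 2 (up_log 2 n) %/ 4)%N.

(** For J = up_log 2 (up_log 2 n) the number 2^J is at most 4 / ln 2 * ln n, and
    4^(9/4 J) = (2^J)^(9/2); the proof compares squares to stay with integer exponents. *)
Lemma law_length_bound (R : realType) (n : nat) : (1 < n)%N ->
  (4 ^+ (law_exponent n) <= (4 / ln 2 * ln n%:R) `^ (9 / 2) :> R).
Proof.
move=> n1; set u := up_log 2 n; set J := up_log 2 u.
have ln2_gt0 : 0 < ln (2 : R) by apply: ln_gt0; rewrite ltr1n.
have lnn : ln 2 <= ln (n%:R : R) by rewrite ler_ln ?posrE ?ltr0n ?ler_nat // ltnW.
set B := 4 / ln 2 * ln n%:R.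
have B0 : 0 <= B by rewrite !mulr_ge0 ?invr_ge0 ?(ltW ln2_gt0) // (le_trans _ lnn) // ltW.
have u0 : (0 < u)%N by rewrite up_log_gt0.
have un : u%:R * ln 2 <= 2 * ln (n%:R : R).
  have /andP[lt _] := up_log_bounds (isT : (1 < 2)%N) n1.
  have le_u : u.-1%:R * ln (2 : R) <= ln n%:R.
    rewrite mulr_natl -lnXn // -natrX.
    by rewrite ler_ln ?posrE ?ltr0n ?expn_gt0 ?ler_nat ?(ltnW n1) // ltnW.
  have -> : u%:R = u.-1%:R + 1 :> R by rewrite natr1 prednK.
  rewrite mulrDl mul1r (mulr_natl _ 2) mulr2n; exact: lerD.
have JB : 2 ^+ J <= B.
  have Ju : (2 ^ J <= 2 * u)%N.
    have [u1|u1] := leqP u 1.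
      by have -> : u = 1%N by [lia]; rewrite /J (_ : u = 1%N) ?up_log1 //; lia.
    have J0 : (0 < J)%N by rewrite up_log_gt0.
    have /andP[lt _] := up_log_bounds (isT : (1 < 2)%N) u1.
    by rewrite -(prednK J0) expnS leq_mul2l ltnW.
  rewrite -natrX (@le_trans _ _ (2 * u)%:R) ?ler_nat //.
  rewrite /B mulrAC ler_pdivlMr // natrM -mulrA.
  by rewrite -[4]/((2 * 2)%:R) natrM -mulrA ler_pM2l.
rewrite -(@ler_pXn2r _ 2) ?nnegrE ?exprn_ge0 ?powR_ge0 //.
have -> : (B `^ (9 / 2)) ^+ 2 = B ^+ 9.
  rewrite -powR_mulrn ?powR_ge0 // -powRrM divfK ?pnatr_eq0 // (powR_mulrn 9) //.
rewrite -exprM; apply: (@le_trans _ _ ((2 ^+ J) ^+ 9)); last first.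
  by rewrite ler_pXn2r // nnegrE ?exprn_ge0.
rewrite -(_ : 2 ^+ 2 = 4) -?exprM; last by rewrite -natrX.
rewrite ler_eXn2l ?ltr1n // /law_exponent -/u -/J; lia.
Qed.

Theorem proposition3p2 (R : realType) :
  exists v : nat -> Free2,
    [/\ forall n : nat, v n <> 1%g,
        forall (n : nat) (gT : finGroupType) (G : {group gT}),
          solvable G -> (#|G| <= n)%N -> is_law (v n) G
      & exists (C : R) (n0 : nat), forall n : nat, (n0 <= n)%N ->
          (Free2_length (v n))%:R <= C * (ln n%:R) `^ (9 / 2)].
Proof.
exists (fun n => der_word (law_exponent n + 43)); split=> [n|n gT G solG leGn|].
- exact: der_word_neq1.
- apply: der_word_law; apply: solvable_derived_length => //.
  apply: leq_trans leGn _; apply: leq_trans (up_logP _ (isT : (1 < 2)%N)) _.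
  by rewrite leq_exp2l // up_logP.
- exists (4 ^+ 43 * (4 / ln 2) `^ (9 / 2)), 2%N => n n1.
  have ln2_gt0 : 0 < ln (2 : R) by apply: ln_gt0; rewrite ltr1n.
  rewrite (le_trans (y := (4 ^ (law_exponent n + 43))%:R)) ?ler_nat ?Free2_length_der_word //.
  rewrite natrX exprD mulrC -mulrA ler_pM2l ?exprn_gt0 //.
  rewrite -powRM ?law_length_bound //.
    by rewrite divr_ge0 // ltW.
  by rewrite ln_ge0 // ler1n ltnW.
Qed.
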